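(* For $n\ge0$ let $$p_n=\sum_{k=0}^n\binom{n+\frac16}{k}\binom{n-\frac16}{n-k}\Bigl(\frac13\Bigr)_{n+k},\qquad q_n=\sum_{k=0}^n\binom{n-\frac16}{k}\binom{n+\frac16}{n-k}\Bigl(\frac12\Bigr)_{n+k}.$$ Then both sequences $f_n=p_n$ and $f_n=q_n$ satisfy, for all $n\ge0$, the third-order linear recurrence $$\begin{aligned} &7776(n+3)(n+2)(1728n^4+6228n^3+7986n^2+4538n+963)f_{n+3}\\ &=36(2985984n^7+33654528n^6+155405952n^5+379069848n^4+525871008n^3\\ &\quad+415828470n^2+175094660n+30377295)(n+2)f_{n+2}\\ &\quad-6(6n+11)(6n+13)(995328n^8+11384064n^7+55911168n^6+154077840n^5\\ &\quad+260388504n^4+275942444n^3+178728654n^2+64534088n+9914615)f_{n+1}\\ &\quad+(6n+11)(6n+5)(2n+1)(3n+1)(6n+13)(6n+7)(1728n^4+13140n^3\\ &\quad+37038n^2+46106n+21443)f_n \end{aligned}$$ with the initial values $p_0=1$, $p_1=43/54$, $p_2=12871/1458$ and $q_0=1$, $q_1=29/24$, $q_2=5149/384$, and $$\frac{\Gamma(1/2)}{\Gamma(1/3)}-\frac{p_n}{q_n}=e^{-2\sqrt{2n}}\Bigl(\frac{\sqrt{\pi}}{\Gamma(1/3)}+O(n^{-1/2})\Bigr)\qquad\text{as } n\to\infty.$$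
   Context: $(a)_0=1$ and $(a)_m=a(a+1)\cdots(a+m-1)$ for $m\ge1$ is the Pochhammer symbol. For real $\alpha$ and an integer $k\ge 0$, $\binom{\alpha}{k}=\alpha(\alpha-1)\cdots(\alpha-k+1)/k!$. *)

(* Defs.v *)
From mathcomp Require Import all_boot all_order all_algebra.
From mathcomp Require Import all_classical all_reals all_analysis.

Set Implicit Arguments.
Unset Strict Implicit.
Unset Printing Implicit Defensive.

Import Order.TTheory GRing.Theory Num.Theory.
Import numFieldNormedType.Exports.

Local Open Scope classical_set_scope.
Local Open Scope ring_scope.

(* Euler's integral; meaningful for 0 < a only, which covers the arguments 1/2
   and 1/3 used below (for a <= 0 the integral is +oo and the value is junk). *)
Definition Gamma (R : realType) (a : R) : R :=
  \int[lebesgue_measure]_(t in `]0, +oo[) (t `^ (a - 1) * expR (- t)).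

Definition pochhammer (R : realType) (a : R) (m : nat) : R :=
  \prod_(i < m) (a + i%:R).

Definition gbinom (R : realType) (a : R) (k : nat) : R :=
  (\prod_(i < k) (a - i%:R)) / k`!%:R.

Definition p_seq (R : realType) (n : nat) : R :=
  \sum_(k < n.+1) gbinom (n%:R + 1 / 6) k * gbinom (n%:R - 1 / 6) (n - k)
                  * pochhammer (1 / 3) (n + k).

Definition q_seq (R : realType) (n : nat) : R :=
  \sum_(k < n.+1) gbinom (n%:R - 1 / 6) k * gbinom (n%:R + 1 / 6) (n - k)
                  * pochhammer (1 / 2) (n + k).

(* The explicit %:R keeps the large literals as Nat.of_num_uint applications; a
   bare ring_scope numeral would be expanded to a unary nat. *)
Definition satisfies_recurrence (R : realType) (f : nat -> R) : Prop :=
  forall n : nat, let x : R := n%:R in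
  7776%:R * (x + 3) * (x + 2)
    * (1728%:R * x ^+ 4 + 6228%:R * x ^+ 3 + 7986%:R * x ^+ 2
       + 4538%:R * x + 963)
    * f n.+3
  = 36 * (2985984%:R * x ^+ 7 + 33654528%:R * x ^+ 6 + 155405952%:R * x ^+ 5
          + 379069848%:R * x ^+ 4 + 525871008%:R * x ^+ 3
          + 415828470%:R * x ^+ 2 + 175094660%:R * x + 30377295%:R) * (x + 2) * f n.+2
    - 6 * (6 * x + 11) * (6 * x + 13)
      * (995328%:R * x ^+ 8 + 11384064%:R * x ^+ 7 + 55911168%:R * x ^+ 6
         + 154077840%:R * x ^+ 5 + 260388504%:R * x ^+ 4 + 275942444%:R * x ^+ 3
         + 178728654%:R * x ^+ 2 + 64534088%:R * x + 9914615%:R) * f n.+1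
    + (6 * x + 11) * (6 * x + 5) * (2 * x + 1) * (3 * x + 1)
      * (6 * x + 13) * (6 * x + 7)
      * (1728%:R * x ^+ 4 + 13140%:R * x ^+ 3 + 37038%:R * x ^+ 2
         + 46106%:R * x + 21443%:R)
      * f n.

(* Main.v *)
(* The recurrence follows from Zeilberger's method with explicit certificates.

   For the asymptotics, put t = s ^ 2 in Euler's integral: with nu = 1 / 6,
   x = ln s and y(x) = s ^ (nu - n) Q_n(s ^ 2), where
   Q_n(t) = \sum_k C(n - nu, k) C(n + nu, n - k) t ^ k, the numbers
   Gamma(1/2) q_n and Gamma(1/3) p_n are the integrals over s > 0 of
   w(s) y(x) and w(s) y(- x), w(s) = 2 s ^ (3 n - nu) e ^ (- s ^ 2).  Moreover
     y(x) = c * (\int_0^pi (2 cosh x + 2 cos t) ^ n cos (nu t) dt / sin (nu pi)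
                 + \int_0^x (2 cosh x - 2 cosh u) ^ n e ^ (nu u) du)
   with c = nu \prod_(m <= n) (m ^ 2 - nu ^ 2) / n! ^ 2, so that y(x) - y(- x)
   only involves the second integral, with 2 cosh (nu u) in place of
   e ^ (nu u).  Replacing nu by 1 / 2 inside the integrals makes them elementary
   and costs a relative error O(s / n); as 2 sin (nu pi) = 1, this gives
     y(x) ~ 2 c beta_n (s + 1) ^ (2 n + 1) s ^ (- n - 1 / 2),
     y(x) - y(- x) ~ 2 c beta_n (s - 1) ^ (2 n + 1) s ^ (- n - 1 / 2)
   where beta_n = \int_0^1 (1 - w ^ 2) ^ n dw.  Under the substitutions
   s = v - 1 / 2 and s = v + 1 / 2 the two integrands differ essentially by
   e ^ (2 v), and Laplace's method at v = sqrt (2 n) yields the ratio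
   e ^ (- 2 sqrt (2 n)) (1 + O(n ^ (- 1 / 2))).  The common factor
   c beta_n is never estimated. *)
Require Import Defs.
From mathcomp Require Import all_boot all_order all_algebra.
From mathcomp Require Import all_classical all_reals all_analysis.
From mathcomp Require Import measurable_realfun.
From mathcomp Require Import ring lra zify.

Set Implicit Arguments.
Unset Strict Implicit.
Unset Printing Implicit Defensive.

Import Order.TTheory GRing.Theory Num.Theory.
Import numFieldNormedType.Exports.

Local Open Scope classical_set_scope.
Local Open Scope ring_scope.

(** * The recurrence *)

Section recurrence.
Variable R : realType.
Implicit Types (x a nu : R).

(** The two integrals differ relatively only by about e^(-2 sqrt(2n)), so separate estimates of p_n
    and q_n with power-type errors say nothing about the difference: it needs an exact formula of
    its own. The odd part y(x) - y(-x) gives one, since the cosine integral is even in x and drops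
    out. One weight serves both sequences because 1/2 - 1/3 = nu. The value 1/2 is put for nu
    because the kernels are functions of w = 2 sinh(u/2), respectively w = 2 sin(t/2), and the new
    factor cosh(u/2), respectively cos(t/2), is just what dw supplies, so that only (c^2 - w^2)^n dw
    is left. The price, a relative error of order s/n, is n^(-1/2) at the saddle s ~ sqrt(2n), which
    is the error allowed. The inner integrals over u and t are never formed: increments of explicit
    primitives are compared through their derivatives, and measure theory enters only for the
    integral over s. *)

Lemma gbinomS x m : gbinom (x + 1) m.+1 * m.+1%:R = gbinom x m * (x + 1).
Proof.
rewrite /gbinom big_ord_recl factS natrM subr0.
have -> : \prod_(i < m) (x + 1 - (lift ord0 i)%:R) = \prod_(i < m) (x - i%:R).
  by apply: eq_bigr => i _; rewrite lift0 -natr1; ring.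
have mf : (m`!%:R : R) != 0 by rewrite pnatr_eq0 -lt0n fact_gt0.
have mS : (m.+1%:R : R) != 0 by rewrite pnatr_eq0.
by field; rewrite mf nat1r.
Qed.

Lemma gbinomDl x m : gbinom x m * (x + 1) = gbinom (x + 1) m * (x + 1 - m%:R).
Proof.
rewrite /gbinom -mulrAC -[RHS]mulrAC; congr (_ / _).
transitivity (\prod_(i < m.+1) (x + 1 - i%:R)); last by rewrite big_ord_recr.
rewrite big_ord_recl subr0 mulrC; congr (_ * _).
by apply: eq_bigr => i _; rewrite lift0 -natr1; ring.
Qed.

Lemma pochhammerS a m : pochhammer a m.+1 = pochhammer a m * (a + m%:R).
Proof. by rewrite /pochhammer big_ord_recr. Qed.

Definition hyper_sum nu a n : R :=
  \sum_(k < n.+1) gbinom (n%:R + nu) k * gbinom (n%:R - nu) (n - k)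
                  * pochhammer a (n + k).

Lemma p_seqE : p_seq R = hyper_sum (1 / 6) (1 / 3).
Proof. by []. Qed.

Lemma q_seqE : q_seq R = hyper_sum (- (1 / 6)) (1 / 2).
Proof. by apply/funext => n; rewrite /q_seq /hyper_sum opprK. Qed.

(** For k > n the truncated [n - k] is 0 and the second binomial would be 1, not 0. The explicit
    zero lets the sums of index n to n + 3 run over one common range. *)
Definition padded_binom nu n k : R :=
  if (k <= n)%N then gbinom (n%:R + nu) k * gbinom (n%:R - nu) (n - k) else 0.

Lemma hyper_sum_padded nu a n N : (n < N)%N ->
  hyper_sum nu a n
  = \sum_(0 <= k < N) padded_binom nu n k * pochhammer a (n + k).
Proof.
move=> nN; rewrite (big_cat_nat (n := n.+1)) //= [X in _ + X]big_nat_cond.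
rewrite [X in _ + X]big1 ?addr0 => [|k]; last first.
  by rewrite andbT => /andP[nk _]; rewrite /padded_binom leqNgt nk mul0r.
by rewrite big_mkord; apply: eq_bigr => k _;
  rewrite /padded_binom -ltnS ltn_ord.
Qed.

(* At [k = n + 1] the left side is 0 by padding and the right side because of
   its last factor. *)
Lemma padded_binomS nu n k : (k <= n.+1)%N ->
  padded_binom nu n k * ((n%:R + 1 + nu) * (n%:R + 1 - nu))
  = padded_binom nu n.+1 k * ((n%:R + 1 + nu - k%:R) * (n%:R + 1 - k%:R)).
Proof.
rewrite leq_eqVlt => /predU1P[->|kn].
  by rewrite /padded_binom ltnn mul0r -natr1 subrr !mulr0.
rewrite ltnS in kn.
rewrite /padded_binom kn leqW // subSn //.
have e1 := gbinomDl (n%:R + nu) k.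
have e2 := gbinomS (n%:R - nu) (n - k).
have -> : n.+1%:R + nu = n%:R + nu + 1 by rewrite -natr1; ring.
have -> : n.+1%:R - nu = n%:R - nu + 1 by rewrite -natr1; ring.
have e3 : (n - k).+1%:R = n%:R + 1 - k%:R :> R.
  by rewrite -natr1 natrB //; ring.
rewrite e3 in e2.
transitivity (gbinom (n%:R + nu) k * (n%:R + nu + 1)
    * (gbinom (n%:R - nu) (n - k) * (n%:R - nu + 1))); first by ring.
by rewrite e1 -e2; ring.
Qed.

(** The ratio of neighbouring terms with denominators cleared, so that it survives at k = n, where
    padding kills the left side and n - k the right. Its factor on the left is the origin of k (k -
    nu) in the certificate identity. *)
Lemma padded_binom_next nu n k : (k <= n)%N ->
  padded_binom nu n k.+1 * ((k%:R + 1) * (k%:R + 1 - nu))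
  = padded_binom nu n k * ((n%:R + nu - k%:R) * (n%:R - k%:R)).
Proof.
rewrite leq_eqVlt => /predU1P[->|kn].
  by rewrite /padded_binom ltnn mul0r subrr !mulr0.
rewrite /padded_binom kn (ltnW kn).
have e : (n - k)%N = (n - k.+1).+1 by rewrite subnSK.
have e1 : gbinom (n%:R + nu) k.+1 * (k%:R + 1)
    = gbinom (n%:R + nu) k * (n%:R + nu - k%:R).
  rewrite /gbinom big_ord_recr factS natrM /= -natr1.
  have mf : (k`!%:R : R) != 0 by rewrite pnatr_eq0 -lt0n fact_gt0.
  have mS : (k%:R + 1 : R) != 0 by rewrite natr1 pnatr_eq0.
  by field; rewrite mf.
have e2 : gbinom (n%:R - nu) (n - k) * (n%:R - k%:R)
    = gbinom (n%:R - nu) (n - k.+1) * (k%:R + 1 - nu).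
  rewrite e /gbinom big_ord_recr factS natrM /= -natr1 natrB // -natr1.
  have mf : ((n - k.+1)`!%:R : R) != 0 by rewrite pnatr_eq0 -lt0n fact_gt0.
  have mS : (n%:R - (k%:R + 1) + 1 : R) != 0.
    by rewrite opprD addrA subrK subr_eq0 eqr_nat gtn_eqF.
  by field; rewrite mf.
transitivity ((gbinom (n%:R + nu) k.+1 * (k%:R + 1)) *
  (gbinom (n%:R - nu) (n - k.+1) * (k%:R + 1 - nu))); first by ring.
by rewrite e1 -e2; ring.
Qed.

(* Zeilberger's method: [certificate] makes the combination of the summands the
   difference in [k] of
   [k * (k - nu) * c k * padded_binom nu n.+3 k * pochhammer a (n + k)]. *)
Lemma recurrence_of_certificate nu a n (e0 e1 e2 e3 : R) (c : R -> R)
    (x := n%:R : R) (d := fun i => (x + i + nu) * (x + i - nu))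
    (u := fun i k => (x + i + nu - k) * (x + i - k))
    (v := fun i k => a + x + k + i) :
  (forall k, e0 * (u 1 k * u 2 k * u 3 k) + e1 * (u 2 k * u 3 k * v 0 k)
             + e2 * (u 3 k * v 0 k * v 1 k) + e3 * (v 0 k * v 1 k * v 2 k)
             = u 3 k * v 0 k * c (k + 1) - k * (k - nu) * c k) ->
  e0 * (d 1 * d 2 * d 3) * hyper_sum nu a n
  + e1 * (d 2 * d 3) * hyper_sum nu a n.+1
  + e2 * d 3 * hyper_sum nu a n.+2 + e3 * hyper_sum nu a n.+3 = 0.
Proof.
move=> certificate.
rewrite !(@hyper_sum_padded _ _ _ n.+4); try lia.
rewrite !mulr_sumr -!big_split /=.
pose b k := padded_binom nu n.+3 k.
pose G k : R := k%:R * (k%:R - nu) * c k%:R * b k * pochhammer a (n + k).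
transitivity (\sum_(0 <= k < n.+4) (G k.+1 - G k)); last first.
  (* [G] vanishes at 0 by its factor k and at n + 4 by the padding. *)
  rewrite telescope_sumr // /G /b /padded_binom ltnn mul0r mulr0 !mul0r subr0.
  by [].
apply: eq_big_nat => k /andP[_ kn]; rewrite ltnS in kn.
rewrite !addSn !pochhammerS.
have e2' : padded_binom nu n.+2 k * d 3 = b k * u 3 k%:R.
  have := padded_binomS nu kn.
  have -> : n.+2%:R + 1 = x + 3 :> R by rewrite /x -!natr1; ring.
  by [].
have e1' : padded_binom nu n.+1 k * (d 2 * d 3) = b k * (u 2 k%:R * u 3 k%:R).
  (* The chain of [padded_binomS] stops at k = n + 2; at k = n + 3 the left side is padded and [u 3]
     contains the vanishing factor x + 3 - k. *)
  case: (leqP k n.+2) => kn2; last first.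
    have -> : k = n.+3 by apply/eqP; rewrite eqn_leq kn.
    rewrite /padded_binom leqNgt leqnSn mul0r /u.
    have -> : n.+3%:R = x + 3 by rewrite /x -!natr1; ring.
    by ring.
  have e : padded_binom nu n.+1 k * d 2 = padded_binom nu n.+2 k * u 2 k%:R.
    have := padded_binomS nu kn2.
    by have -> : n.+1%:R + 1 = x + 2 :> R by rewrite /x -!natr1; ring.
  by rewrite mulrA e mulrAC e2'; ring.
have e0' : padded_binom nu n k * (d 1 * d 2 * d 3)
    = b k * (u 1 k%:R * u 2 k%:R * u 3 k%:R).
  case: (leqP k n.+1) => kn1; last first.
    rewrite /padded_binom leqNgt (ltnW kn1) mul0r /u.
    have [->|->] : k = n.+2 \/ k = n.+3 by lia.
      have -> : n.+2%:R = x + 2 by rewrite /x -!natr1; ring.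
      by ring.
    have -> : n.+3%:R = x + 3 by rewrite /x -!natr1; ring.
    by ring.
  have e : padded_binom nu n k * d 1 = padded_binom nu n.+1 k * u 1 k%:R.
    exact: padded_binomS.
  transitivity ((padded_binom nu n k * d 1) * (d 2 * d 3)); first by ring.
  by rewrite e mulrAC e1'; ring.
have eb : b k.+1 * ((k%:R + 1) * (k%:R + 1 - nu)) = b k * u 3 k%:R.
  have := padded_binom_next nu kn.
  by have -> : n.+3%:R = x + 3 by rewrite /x -!natr1; ring.
have p1 : a + (n + k)%:R = v 0 k%:R by rewrite natrD /v /x; ring.
have p2 : a + (n + k).+1%:R = v 1 k%:R by rewrite -natr1 natrD /v /x; ring.
have p3 : a + (n + k).+2%:R = v 2 k%:R by rewrite -!natr1 natrD /v /x; ring.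
rewrite p1 p2 p3 /G addnS pochhammerS p1 -(natr1 k) -/(b k).
transitivity ((pochhammer a (n + k)) * b k
  * (e0 * (u 1 k%:R * u 2 k%:R * u 3 k%:R)
  + e1 * (u 2 k%:R * u 3 k%:R * v 0 k%:R)
  + e2 * (u 3 k%:R * v 0 k%:R * v 1 k%:R)
  + e3 * (v 0 k%:R * v 1 k%:R * v 2 k%:R))).
  transitivity (e0 * pochhammer a (n + k)
    * (padded_binom nu n k * (d 1 * d 2 * d 3))
    + e1 * pochhammer a (n + k) * v 0 k%:R
      * (padded_binom nu n.+1 k * (d 2 * d 3))
    + e2 * pochhammer a (n + k) * v 0 k%:R * v 1 k%:R
      * (padded_binom nu n.+2 k * d 3)
    + e3 * (b k * (pochhammer a (n + k) * v 0 k%:R * v 1 k%:R * v 2 k%:R))).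
    by ring.
  by rewrite e0' e1' e2'; ring.
rewrite certificate.
transitivity (b k.+1 * ((k%:R + 1) * (k%:R + 1 - nu)) * c (k%:R + 1)
  * (pochhammer a (n + k) * v 0 k%:R)
  - k%:R * (k%:R - nu) * c k%:R * b k * pochhammer a (n + k)).
  by rewrite eb; ring.
by ring.
Qed.

(** The four coefficients are normalized so that, multiplied by the factors [d] of
    [recurrence_of_certificate], they become 36 (x + 3)^2 - 1 times those of the recurrence with all
    terms on one side. *)
Definition coef0 x : R :=
  - 36 ^+ 3 * (2 * x + 1) * (3 * x + 1)
  * (1728%:R * x ^+ 4 + 13140%:R * x ^+ 3 + 37038%:R * x ^+ 2
     + 46106%:R * x + 21443%:R).

Definition coef1 x : R :=
  36 ^+ 2 * 6
  * (995328%:R * x ^+ 8 + 11384064%:R * x ^+ 7 + 55911168%:R * x ^+ 6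
     + 154077840%:R * x ^+ 5 + 260388504%:R * x ^+ 4 + 275942444%:R * x ^+ 3
     + 178728654%:R * x ^+ 2 + 64534088%:R * x + 9914615%:R).

Definition coef2 x : R :=
  - 36 ^+ 2
  * (2985984%:R * x ^+ 7 + 33654528%:R * x ^+ 6 + 155405952%:R * x ^+ 5
     + 379069848%:R * x ^+ 4 + 525871008%:R * x ^+ 3
     + 415828470%:R * x ^+ 2 + 175094660%:R * x + 30377295%:R) * (x + 2).

Definition coef3 x : R :=
  (36 * (x + 3) ^+ 2 - 1) * (7776%:R * (x + 3) * (x + 2)
  * (1728%:R * x ^+ 4 + 6228%:R * x ^+ 3 + 7986%:R * x ^+ 2
     + 4538%:R * x + 963%:R)).

(** Degree 3 in k balances the k^6 terms of u 1 * u 2 * u 3 and u 3 * v 0 * c (k + 1). This forces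
    the k^3 coefficient to be [coef0 x], which is why [certificate_q] has the same one. *)
Definition certificate_p x k : R :=
    (639075311136%:R + 4598430876576%:R * x + 14427357624576%:R * x ^+ 2 +
     26054345443968%:R * x ^+ 3 + 30085686449856%:R * x ^+ 4 +
     23284803511296%:R * x ^+ 5 + 12263123972736%:R * x ^+ 6 +
     4346239306752%:R * x ^+ 7 + 992616104448%:R * x ^+ 8 + 131896885248%:R
     * x ^+ 9 + 7739670528%:R * x ^+ 10)
    + (- 505163340288%:R - 3474365858784%:R * x - 10257593817024%:R * x ^+ 2
     - 17085047523840%:R * x ^+ 3 - 17738443456128%:R * x ^+ 4 -
     11942734421376%:R * x ^+ 5 - 5229434027520%:R * x ^+ 6 -
     1439273028096%:R * x ^+ 7 - 226224119808%:R * x ^+ 8 - 15479341056%:R *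
     x ^+ 9) * k
    + (85766566176%:R + 568814944320%:R * x + 1585775511936%:R * x ^+ 2 +
     2430213497856%:R * x ^+ 3 + 2252704058496%:R * x ^+ 4 +
     1301052948480%:R * x ^+ 5 + 459364898304%:R * x ^+ 6 + 90941128704%:R *
     x ^+ 7 + 7739670528%:R * x ^+ 8) * k ^+ 2
    + (- 1000444608%:R - 7153344576%:R * x - 18486320256%:R * x ^+ 2 -
     22160013696%:R * x ^+ 3 - 13514190336%:R * x ^+ 4 - 4081466880%:R * x
     ^+ 5 - 483729408%:R * x ^+ 6) * k ^+ 3.

Definition certificate_q x k : R :=
    (557259194016%:R + 4035137197896%:R * x + 12761722390032%:R * x ^+ 2 +
     23274240861168%:R * x ^+ 3 + 27191791754208%:R * x ^+ 4 +
     21330469238400%:R * x ^+ 5 + 11404309531392%:R * x ^+ 6 +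
     4108886611200%:R * x ^+ 7 + 955127075328%:R * x ^+ 8 + 129316995072%:R
     * x ^+ 9 + 7739670528%:R * x ^+ 10)
    + (- 476657855280%:R - 3285356989392%:R * x - 9730542506400%:R * x ^+ 2
     - 16276823025696%:R * x ^+ 3 - 16988668285824%:R * x ^+ 4 -
     11509390227456%:R * x ^+ 5 - 5076352705536%:R * x ^+ 6 -
     1408959318528%:R * x ^+ 7 - 223644229632%:R * x ^+ 8 - 15479341056%:R *
     x ^+ 9) * k
    + (85266343872%:R + 565238272032%:R * x + 1576532351808%:R * x ^+ 2 +
     2419133491008%:R * x ^+ 3 + 2245946963328%:R * x ^+ 4 +
     1299012215040%:R * x ^+ 5 + 459123033600%:R * x ^+ 6 + 90941128704%:R *
     x ^+ 7 + 7739670528%:R * x ^+ 8) * k ^+ 2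
    + (- 1000444608%:R - 7153344576%:R * x - 18486320256%:R * x ^+ 2 -
     22160013696%:R * x ^+ 3 - 13514190336%:R * x ^+ 4 - 4081466880%:R * x
     ^+ 5 - 483729408%:R * x ^+ 6) * k ^+ 3.

(** The factors [d] depend on nu only through nu^2, so that nu = 1/6 and nu = -1/6 lead to the same
    recurrence; the surplus factor 36 (x + 3)^2 - 1 is positive for x >= 0 and is cancelled. *)
Lemma satisfies_recurrence_hyper_sum nu a (c : R -> R -> R) : nu ^+ 2
  = 1 / 36 ->
  (forall x k (u := fun i => (x + i + nu - k) * (x + i - k))
     (v := fun i => a + x + k + i),
     coef0 x * (u 1 * u 2 * u 3) + coef1 x * (u 2 * u 3 * v 0)
     + coef2 x * (u 3 * v 0 * v 1) + coef3 x * (v 0 * v 1 * v 2)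
     = u 3 * v 0 * c x (k + 1) - k * (k - nu) * c x k) ->
  satisfies_recurrence (hyper_sum nu a).
Proof.
move=> nu2 cert n x.
have d y : (y + nu) * (y - nu) = (36 * y ^+ 2 - 1) / 36.
  by rewrite mulrC -subr_sqr nu2; field.
(* Stated for abstract coefficients, to keep the large polynomials out of the rewriting with [d]. *)
have gen (e0 e1 e2 e3 f0 f1 f2 f3 : R) :
    e0 * (((x + 1 + nu) * (x + 1 - nu)) * ((x + 2 + nu) * (x + 2 - nu))
         * ((x + 3 + nu) * (x + 3 - nu))) * f0
    + e1 * (((x + 2 + nu) * (x + 2 - nu)) * ((x + 3 + nu) * (x + 3 - nu))) * f1
    + e2 * ((x + 3 + nu) * (x + 3 - nu)) * f2 + e3 * f3 = 0 ->
    e0 * ((36 * (x + 1) ^+ 2 - 1) / 36 * ((36 * (x + 2) ^+ 2 - 1) / 36)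
         * ((36 * (x + 3) ^+ 2 - 1) / 36)) * f0
    + e1 * ((36 * (x + 2) ^+ 2 - 1) / 36 * ((36 * (x + 3) ^+ 2 - 1) / 36)) * f1
    + e2 * ((36 * (x + 3) ^+ 2 - 1) / 36) * f2 + e3 * f3 = 0.
  by rewrite !d.
have e := gen _ _ _ _ _ _ _ _ (@recurrence_of_certificate nu a n (coef0 x)
  (coef1 x) (coef2 x) (coef3 x) (c x) (cert x)).
have d3 : 36 * (x + 3) ^+ 2 - 1 != 0.
  have : 0 <= x by rewrite ler0n.
  by move=> ?; apply/eqP; nra.
apply: (mulfI d3); apply: subr0_eq; apply: etrans e.
by rewrite /coef0 /coef1 /coef2 /coef3; field.
Qed.

Lemma p_seq_recurrence : satisfies_recurrence (p_seq R).
Proof.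
rewrite p_seqE; apply: (@satisfies_recurrence_hyper_sum _ _ certificate_p) =>
  [|x k u v].
  by field.
by rewrite /u /v /coef0 /coef1 /coef2 /coef3 /certificate_p; field.
Qed.

Lemma q_seq_recurrence : satisfies_recurrence (q_seq R).
Proof.
rewrite q_seqE; apply: (@satisfies_recurrence_hyper_sum _ _ certificate_q) =>
  [|x k u v].
  by field.
by rewrite /u /v /coef0 /coef1 /coef2 /coef3 /certificate_q; field.
Qed.
End recurrence.

Section initial_values.
Variable R : realType.

Lemma gbinom0 (x : R) : gbinom x 0 = 1.
Proof. by rewrite /gbinom big_ord0 divr1. Qed.

Lemma gbinom1 (x : R) : gbinom x 1 = x.
Proof. by rewrite /gbinom big_ord_recr big_ord0 /= subr0 mul1r divr1. Qed.

Lemma gbinom2 (x : R) : gbinom x 2 = x * (x - 1) / 2.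
Proof. by rewrite /gbinom !big_ord_recr big_ord0 /= subr0 mul1r. Qed.

Lemma pochhammer0 (a : R) : pochhammer a 0 = 1.
Proof. by rewrite /pochhammer big_ord0. Qed.

Lemma p_seq_initial :
  [/\ p_seq R 0 = 1, p_seq R 1 = 43 / 54 & p_seq R 2 = 12871%:R / 1458%:R].
Proof.
by split; rewrite /p_seq !big_ord_recr big_ord0 [LHS]/= ?subnn ?subn0 ?subSS
  ?subn0
  ?(addn0, add0n, addSn, addnS) ?(gbinom0, gbinom1, gbinom2) ?pochhammerS
  pochhammer0; field.
Qed.

Lemma q_seq_initial :
  [/\ q_seq R 0 = 1, q_seq R 1 = 29 / 24 & q_seq R 2 = 5149%:R / 384].
Proof.
by split; rewrite /q_seq !big_ord_recr big_ord0 [LHS]/= ?subnn ?subn0 ?subSS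
  ?subn0
  ?(addn0, add0n, addSn, addnS) ?(gbinom0, gbinom1, gbinom2) ?pochhammerS
  pochhammer0; field.
Qed.
End initial_values.

(** * Integral representation of the Jacobi-type polynomials *)

Section calculus.
Variable R : realType.

Lemma is_derive_bigsum (n : nat) (h : 'I_n -> R -> R) (x : R) (dh : 'I_n -> R) :
  (forall i, is_derive x 1 (h i) (dh i)) ->
  is_derive x 1 (fun y => \sum_(i < n) h i y) (\sum_(i < n) dh i).
Proof. by move=> H; rewrite -fct_sumE; apply: is_derive_sum. Qed.

Lemma is_derive_addf (f g : R -> R) (x df dg : R) :
  is_derive x 1 f df -> is_derive x 1 g dg ->
  is_derive x 1 (fun y => f y + g y) (df + dg).
Proof. exact: is_deriveD. Qed.

Lemma is_derive_subf (f g : R -> R) (x df dg : R) :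
  is_derive x 1 f df -> is_derive x 1 g dg ->
  is_derive x 1 (fun y => f y - g y) (df - dg).
Proof. exact: is_deriveB. Qed.

Lemma is_derive_mulf (f g : R -> R) (x df dg : R) :
  is_derive x 1 f df -> is_derive x 1 g dg ->
  is_derive x 1 (fun y => f y * g y) (f x * dg + g x * df).
Proof. exact: is_deriveM. Qed.

Lemma is_derive_cmul (c : R) (f : R -> R) (x df : R) :
  is_derive x 1 f df -> is_derive x 1 (fun y => c * f y) (c * df).
Proof. exact: is_deriveZ. Qed.

Lemma is_derive_expn n (f : R -> R) (x df : R) : is_derive x 1 f df ->
  is_derive x 1 (fun y => f y ^+ n.+1) (n.+1%:R * f x ^+ n * df).
Proof. by rewrite -exprfctE => df_; apply: (@is_deriveX _ _ f n.+1). Qed.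

Lemma is_derive_compf (f g : R -> R) (x df dg : R) :
  is_derive (g x) 1 f df -> is_derive x 1 g dg ->
  is_derive x 1 (fun y => f (g y)) (df * dg).
Proof. exact: is_derive1_comp. Qed.

Lemma is_derive_lin (c x : R) : is_derive x 1 ( *%R c) c.
Proof. by have := is_derive_cmul c (is_derive_id x (1 : R)); rewrite mulr1. Qed.

Lemma is_derive_expR_lin (c x : R) :
  is_derive x 1 (fun y => expR (c * y)) (c * expR (c * x)).
Proof.
rewrite mulrC; exact: is_derive_compf (is_derive_expR _) (is_derive_lin c x).
Qed.

Lemma is_derive_sin_lin (c x : R) :
  is_derive x 1 (fun y => sin (c * y)) (c * cos (c * x)).
Proof.
rewrite mulrC; exact: is_derive_compf (is_derive_sin _) (is_derive_lin c x).
Qed.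

(** Plays the part of monotonicity of the integral: the inner integrals are increments of
    primitives, and the mean value theorem for g - f compares them. *)
Lemma derive_increment_le (f g f' g' : R -> R) (a b : R) : a <= b ->
  (forall x : R, is_derive x 1 f (f' x)) ->
    (forall x : R, is_derive x 1 g (g' x)) ->
  (forall x, a <= x <= b -> f' x <= g' x) -> f b - f a <= g b - g a.
Proof.
move=> ab df dg fg.
have d (x : R) : is_derive x 1 (g - f) (g' x - f' x) by exact: is_deriveB.
have cgf : {within `[a, b], continuous (g - f)}.
  apply: continuous_subspaceT => x.
  by apply/differentiable_continuous/derivable1_diffP; case: (d x).
have [c cab e] := MVT_segment ab (fun x _ => d x) cgf.
rewrite -subr_ge0.
have -> : g b - g a - (f b - f a) = (g - f) b - (g - f) a by rewrite !fctE;
  ring.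
by rewrite e mulr_ge0 ?subr_ge0 // fg // -in_itv.
Qed.
End calculus.

(** * Binomial sum identities *)

Section binomial_sums.
Variable R : realType.

Lemma sum_binS n (f : nat -> R) :
  \sum_(i < n.+2) 'C(n.+1, i)%:R * f i = \sum_(i < n.+1) 'C(n, i)%:R
    * (f i + f i.+1).
Proof.
rewrite big_ord_recl bin0.
have -> : \sum_(i < n.+1) 'C(n.+1, lift ord0 i)%:R * f (lift ord0 i)
    = \sum_(i < n.+1) 'C(n, i.+1)%:R * f i.+1 + \sum_(i < n.+1) 'C(n, i)%:R
      * f i.+1.
  by rewrite -big_split; apply: eq_bigr => i _; rewrite lift0 binS natrD mulrDl.
have -> : \sum_(i < n.+1) 'C(n, i)%:R * (f i + f i.+1)
    = \sum_(i < n.+1) 'C(n, i)%:R * f i + \sum_(i < n.+1) 'C(n, i)%:R * f i.+1.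
  by rewrite -big_split; apply: eq_bigr => i _; rewrite mulrDr.
rewrite addrA; congr (_ + _).
by rewrite big_ord_recr /= bin_small // mul0r addr0 big_ord_recl bin0.
Qed.

(** For h i j = X^i Y^j this is the binomial theorem for ((1 + X)(1 + Y))^n. The four-term
    hypothesis also admits cosines, which are not such products but combine by the addition
    formulas. *)
Lemma sum_bin2_geometric n (h : nat -> nat -> R) (k : R) :
  (forall i j, h i j + h i.+1 j + (h i j.+1 + h i.+1 j.+1) = k * h i j) ->
  \sum_(i < n.+1) \sum_(j < n.+1) 'C(n, i)%:R * 'C(n, j)%:R * h i j
  = k ^+ n * h 0 0.
Proof.
move=> hk.
transitivity (\sum_(i < n.+1) 'C(n, i)%:R * \sum_(j < n.+1) 'C(n, j)%:R
  * h i j).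
  apply: eq_bigr => i _; rewrite mulr_sumr.
  by apply: eq_bigr => j _; rewrite mulrA.
elim: n => [|n IH].
  by rewrite !big_ord_recl !big_ord0 bin0 !mul1r !addr0.
rewrite (@sum_binS n (fun i => \sum_(j < n.+2) 'C(n.+1, j)%:R * h i j)).
rewrite exprS -mulrA -IH mulr_sumr; apply: eq_bigr => i _.
rewrite -big_split /= mulrCA; congr (_ * _).
transitivity (\sum_(j < n.+2) 'C(n.+1, j)%:R * (h i j + h i.+1 j)).
  by apply: eq_bigr => j _; rewrite mulrDr.
rewrite (@sum_binS n (fun j => h i j + h i.+1 j)) mulr_sumr.
by apply: eq_bigr => j _; rewrite hk mulrCA.
Qed.

(** Partial fractions of the Beta value at (z, n + 1); the induction applies Pascal's rule and the
    case n at z and z + 1. *)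
Lemma sum_bin_inv n (z : R) : (forall i, (i <= n)%N -> z + i%:R != 0) ->
  \sum_(i < n.+1) 'C(n, i)%:R * ((-1) ^+ i / (z + i%:R))
  = n`!%:R / \prod_(i < n.+1) (z + i%:R).
Proof.
elim: n z => [|n IH] z z0.
  by rewrite !big_ord_recl !big_ord0 bin0 expr0 addr0 !mul1r mulr1.
rewrite (@sum_binS n (fun i => (-1) ^+ i / (z + i%:R))).
transitivity (\sum_(i < n.+1) 'C(n, i)%:R * ((-1) ^+ i / (z + i%:R))
    + \sum_(i < n.+1) 'C(n, i)%:R * ((-1) ^+ i.+1 / (z + i.+1%:R))).
  by rewrite -big_split; apply: eq_bigr => i _; rewrite mulrDr.
rewrite IH => [|i ni]; last by rewrite z0 // leqW.
have -> : \sum_(i < n.+1) 'C(n, i)%:R * ((-1) ^+ i.+1 / (z + i.+1%:R))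
   = - \sum_(i < n.+1) 'C(n, i)%:R * ((-1) ^+ i / (z + 1 + i%:R)).
  rewrite -sumrN; apply: eq_bigr => i _.
  by rewrite exprS -[in LHS]nat1r addrA mulN1r mulNr mulrN.
rewrite IH => [|i ni]; last by rewrite -addrA nat1r z0.
have e : \prod_(i < n.+2) (z + i%:R) = z * \prod_(i < n.+1) (z + 1 + i%:R).
  rewrite big_ord_recl addr0; congr (_ * _).
  by apply: eq_bigr => i _; rewrite lift0 -addrA nat1r.
have z00 : z != 0 by have := z0 0%N isT; rewrite addr0.
have zn : z + n.+1%:R != 0 by exact: z0.
have p0 : \prod_(i < n.+1) (z + i%:R) != 0.
  by apply/prodf_neq0 => i _; rewrite z0 // ltnW.
have e2 : \prod_(i < n.+1) (z + i%:R) * (z + n.+1%:R)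
    = z * \prod_(i < n.+1) (z + 1 + i%:R) by rewrite -e [RHS]big_ord_recr.
have q0 : \prod_(i < n.+1) (z + 1 + i%:R) != 0.
  by apply: contraNneq (mulf_neq0 p0 zn) => q0; rewrite e2 q0 mulr0.
have -> : \prod_(i < n.+1) (z + i%:R)
    = z * \prod_(i < n.+1) (z + 1 + i%:R) / (z + n.+1%:R).
  by rewrite -e2 mulfK.
rewrite e factS natrM; field.
by rewrite q0 z00 nat1r zn.
Qed.
End binomial_sums.

(** * Explicit primitives of the two kernels *)

Section kernel_formula.
Variables (R : realType) (nu : R) (n : nat).
Hypothesis nu_bounds : 0 < `|nu| < 1.

(* With [t = expR (2 * x)] this is [t ^ ((nu - n) / 2)] times the degree-[n]
   polynomial [\sum_k C(n - nu, k) C(n + nu, n - k) t ^ k]. *)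
Definition scaled_jacobi (x : R) : R :=
  \sum_(k < n.+1) gbinom (n%:R - nu) k * gbinom (n%:R + nu) (n - k)
                  * expR ((2 * k%:R - n%:R + nu) * x).

(* Integrals over [u] and [t] below are increments of these explicit
   primitives; they exist because [nu] is not an integer. *)
Definition exp_primitive (x u : R) : R :=
  \sum_(i < n.+1) \sum_(j < n.+1) 'C(n, i)%:R * 'C(n, j)%:R
    * ((-1) ^+ (i + j) * expR ((n%:R - i%:R - j%:R) * x)
       / (i%:R - j%:R + nu) * expR ((i%:R - j%:R + nu) * u)).

Definition cos_primitive (x t : R) : R :=
  \sum_(i < n.+1) \sum_(j < n.+1) 'C(n, i)%:R * 'C(n, j)%:R
    * (expR ((n%:R - i%:R - j%:R) * x)
       / (i%:R - j%:R + nu) * sin ((i%:R - j%:R + nu) * t)).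

Definition exp_kernel (x u : R) : R := expR x + expR (- x) - expR u
  - expR (- u).

Definition cos_kernel (x t : R) : R := expR x + expR (- x) + 2 * cos t.

Definition jacobi_const : R :=
  nu * \prod_(i < n) (i.+1%:R + nu) * \prod_(i < n)
    (i.+1%:R - nu) / (n`!%:R) ^+ 2.

Lemma shift_neq0 (i j : nat) : i%:R - j%:R + nu != 0.
Proof.
have [/andP[n0 n1]] := nu_bounds; apply/eqP => e.
have [ij|ij|ij] := ltngtP i j.
- have : (i.+1%:R : R) <= j%:R by rewrite ler_nat.
  by rewrite -natr1 => H; move: n1; rewrite ltr_norml => /andP[_]; lra.
- have : (j.+1%:R : R) <= i%:R by rewrite ler_nat.
  by rewrite -natr1 => H; move: n1; rewrite ltr_norml => /andP[+ _]; lra.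
- by move: e n0; rewrite ij subrr add0r => ->; rewrite normr0 ltxx.
Qed.

(** Since [exp_kernel x u] is e^x (1 - e^(u-x)) (1 - e^(-u-x)), its n-th power is a double binomial
    sum of exponentials, integrated term by term. *)
Lemma is_derive_exp_primitive (x u : R) :
  is_derive u 1 (exp_primitive x) (exp_kernel x u ^+ n * expR (nu * u)).
Proof.
pose h i j : R := (-1) ^+ (i + j) * expR ((n%:R - i%:R - j%:R) * x)
   * expR ((i%:R - j%:R + nu) * u).
have -> : exp_kernel x u ^+ n * expR (nu * u) =
  \sum_(i < n.+1) \sum_(j < n.+1) 'C(n, i)%:R * 'C(n, j)%:R * h i j.
  rewrite (@sum_bin2_geometric _ n h (exp_kernel x u * expR (- x))).
    have -> : h 0%N 0%N = expR (n%:R * x) * expR (nu * u).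
      by rewrite /h addn0 mulr0n !subr0 add0r mul1r.
    rewrite exprMn -expRM_natl -mulrA; congr (_ * _); rewrite mulrA -expRD.
    have -> : n%:R * - x + n%:R * x = 0 by ring.
    by rewrite expR0 mul1r.
  move=> i j; rewrite /h !(addnS, addSn) !exprS.
  have E1 : expR ((n%:R - i.+1%:R - j%:R) * x) = expR (- x)
    * expR ((n%:R - i%:R - j%:R) * x).
    by rewrite -expRD -natr1; congr expR; ring.
  have E2 : expR ((n%:R - i%:R - j.+1%:R) * x) = expR (- x)
    * expR ((n%:R - i%:R - j%:R) * x).
    by rewrite -expRD -natr1; congr expR; ring.
  have E3 : expR ((n%:R - i.+1%:R - j.+1%:R) * x)
      = expR (- x) * expR (- x) * expR ((n%:R - i%:R - j%:R) * x).
    by rewrite -!expRD -!natr1; congr expR; ring.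
  have F1 : expR ((i.+1%:R - j%:R + nu) * u) = expR u
    * expR ((i%:R - j%:R + nu) * u).
    by rewrite -expRD -natr1; congr expR; ring.
  have F2 : expR ((i%:R - j.+1%:R + nu) * u) = expR (- u)
    * expR ((i%:R - j%:R + nu) * u).
    by rewrite -expRD -natr1; congr expR; ring.
  have F3 : expR ((i.+1%:R - j.+1%:R + nu) * u) = expR ((i%:R - j%:R + nu) * u).
    by rewrite -!natr1; congr expR; ring.
  rewrite E1 E2 E3 F1 F2 F3.
  have -> : exp_kernel x u * expR (- x)
      = 1 + expR (- x) * expR (- x) - (expR u + expR (- u)) * expR (- x).
    by rewrite -[X in X + _ - _](expRxMexpNx_1 x) /exp_kernel; ring.
  by ring.
apply: is_derive_bigsum => i; apply: is_derive_bigsum => j.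
apply: is_derive_cmul.
have := is_derive_cmul ((-1) ^+ (i + j) * expR ((n%:R - i%:R - j%:R) * x)
       / (i%:R - j%:R + nu)) (is_derive_expR_lin (i%:R - j%:R + nu) u).
rewrite mulrA divfK ?shift_neq0 //.
Qed.

(** The same expansion at imaginary argument: the kernel is e^x |1 + e^(it-x)|^2, and the real part
    is taken throughout. *)
Lemma is_derive_cos_primitive (x t : R) :
  is_derive t 1 (cos_primitive x) (cos_kernel x t ^+ n * cos (nu * t)).
Proof.
pose h i j : R := expR ((n%:R - i%:R - j%:R) * x)
  * cos ((i%:R - j%:R + nu) * t).
have -> : cos_kernel x t ^+ n * cos (nu * t) =
  \sum_(i < n.+1) \sum_(j < n.+1) 'C(n, i)%:R * 'C(n, j)%:R * h i j.
  rewrite (@sum_bin2_geometric _ n h (cos_kernel x t * expR (- x))).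
    have -> : h 0%N 0%N = expR (n%:R * x) * cos (nu * t).
      by rewrite /h mulr0n !subr0 add0r.
    rewrite exprMn -expRM_natl -mulrA; congr (_ * _); rewrite mulrA -expRD.
    have -> : n%:R * - x + n%:R * x = 0 by ring.
    by rewrite expR0 mul1r.
  move=> i j; rewrite /h.
  have E1 : expR ((n%:R - i.+1%:R - j%:R) * x) = expR (- x)
    * expR ((n%:R - i%:R - j%:R) * x).
    by rewrite -expRD -natr1; congr expR; ring.
  have E2 : expR ((n%:R - i%:R - j.+1%:R) * x) = expR (- x)
    * expR ((n%:R - i%:R - j%:R) * x).
    by rewrite -expRD -natr1; congr expR; ring.
  have E3 : expR ((n%:R - i.+1%:R - j.+1%:R) * x)
      = expR (- x) * expR (- x) * expR ((n%:R - i%:R - j%:R) * x).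
    by rewrite -!expRD -!natr1; congr expR; ring.
  have F1 : (i.+1%:R - j%:R + nu) * t = (i%:R - j%:R + nu) * t + t
    by rewrite -natr1; ring.
  have F2 : (i%:R - j.+1%:R + nu) * t = (i%:R - j%:R + nu) * t - t
    by rewrite -natr1; ring.
  have F3 : (i.+1%:R - j.+1%:R + nu) * t = (i%:R - j%:R + nu) * t
    by rewrite -!natr1; ring.
  rewrite E1 E2 E3 F1 F2 F3 cosD cosB.
  have -> : cos_kernel x t * expR (- x)
      = 1 + expR (- x) * expR (- x) + 2 * cos t * expR (- x).
    by rewrite -[X in X + _ + _](expRxMexpNx_1 x) /cos_kernel; ring.
  by ring.
apply: is_derive_bigsum => i; apply: is_derive_bigsum => j.
apply: is_derive_cmul.
have := is_derive_cmul (expR ((n%:R - i%:R - j%:R) * x)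
       / (i%:R - j%:R + nu)) (is_derive_sin_lin (i%:R - j%:R + nu) t).
rewrite mulrA divfK ?shift_neq0 //.
Qed.

Lemma cos_primitive0 x : cos_primitive x 0 = 0.
Proof.
by apply: big1 => i _; apply: big1 => j _; rewrite mulr0 sin0 !mulr0.
Qed.

Lemma sin_shift (i j : nat) :
  sin ((i%:R - j%:R + nu) * pi) = (-1) ^+ (i + j) * sin (nu * pi).
Proof.
have sinDn (k : nat) (y : R) : sin (y + k%:R * pi) = (-1) ^+ k * sin y.
  elim: k => [|k IH]; first by rewrite mul0r addr0 mul1r.
  by rewrite -natr1 mulrDl mul1r addrA sinDpi IH exprS mulN1r mulNr.
have := sinDn j ((i%:R - j%:R + nu) * pi).
have -> : (i%:R - j%:R + nu) * pi + j%:R * pi = nu * pi + i%:R * pi by ring.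
rewrite sinDn exprD => e.
by rewrite [X in _ = X * _]mulrC -mulrA e mulrA -expr2 sqrr_sign mul1r.
Qed.

(** The shifts i - j only produce signs at t = pi, the very signs of [exp_primitive]. Thus the
    primitive at u = 0 is the cosine integral over [0, pi] divided by sin (nu pi). *)
Lemma cos_primitive_pi x : cos_primitive x pi = sin (nu * pi)
  * exp_primitive x 0.
Proof.
rewrite /cos_primitive /exp_primitive mulr_sumr; apply: eq_bigr => i _.
rewrite mulr_sumr; apply: eq_bigr => j _.
by rewrite sin_shift mulr0 expR0; ring.
Qed.
End kernel_formula.

(** * Identification of the Jacobi-type sum with the exponential primitive *)

Section scaled_jacobi_formula.
Variables (R : realType) (nu : R).
Hypothesis nu_bounds : 0 < `|nu| < 1.

Let pp m : R := \prod_(i < m) (i.+1%:R + nu).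
Let pm m : R := \prod_(i < m) (i.+1%:R - nu).

Lemma rising_neq0 (mu : R) m : `|mu| < 1 -> \prod_(i < m) (i.+1%:R + mu) != 0.
Proof.
move=> mu1; apply/prodf_neq0 => i _; apply/eqP => e.
have : (1 : R) <= i.+1%:R by rewrite ler1n.
by move: mu1; rewrite ltr_norml => /andP[+ _]; lra.
Qed.

Lemma gbinom_rising (mu : R) m k :
  gbinom ((m + k)%:R + mu) k * k`!%:R * \prod_(i < m) (i.+1%:R + mu)
  = \prod_(i < m + k) (i.+1%:R + mu).
Proof.
elim: k => [|k IH]; first by rewrite gbinom0 fact0 addn0 !mul1r.
rewrite addnS big_ord_recr /= -IH factS natrM.
have -> : (m + k).+1%:R + mu = (m + k)%:R + mu + 1 by rewrite -natr1; ring.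
rewrite mulrA gbinomS; ring.
Qed.

(** Split at i = j: the factors before it are negative shifts and give the sign and [pm j], the
    factor at it is nu, those after it give [pp m]. *)
Lemma prod_shift j m :
  \prod_(i < (j + m).+1) (nu - j%:R + i%:R) = (-1) ^+ j * pm j * (nu * pp m).
Proof.
elim: j => [|j IH].
  rewrite add0n /pm big_ord0 !mul1r big_ord_recl subr0 addr0; congr (_ * _).
  by apply: eq_bigr => i _; rewrite lift0 addrC.
rewrite addSn big_ord_recl addr0.
have -> : \prod_(i < (j + m).+1) (nu - j.+1%:R + (lift ord0 i)%:R)
    = \prod_(i < (j + m).+1) (nu - j%:R + i%:R).
  by apply: eq_bigr => i _; rewrite lift0 -!natr1; ring.
rewrite IH /pm big_ord_recr /= exprS; ring.
Qed.

Lemma jacobi_coef j m (n := (j + m)%N) :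
  jacobi_const nu n * ('C(n, j)%:R * (-1) ^+ j
     * (n`!%:R / \prod_(i < n.+1) (nu - j%:R + i%:R)))
  = gbinom (n%:R - nu) m * gbinom (n%:R + nu) j.
Proof.
have [nu0 nu1] := andP nu_bounds.
have pp0 k : pp k != 0 by exact: rising_neq0.
have pm0 k : pm k != 0 by apply: rising_neq0; rewrite normrN.
have n0 : nu != 0 by rewrite -normr_gt0.
have f0 k : (k`!%:R : R) != 0 by rewrite pnatr_eq0 -lt0n fact_gt0.
have s0 : (-1) ^+ j != 0 :> R by rewrite signr_eq0.
have e1 := gbinom_rising nu m j; rewrite addnC -/n -/(pp m) -/(pp n) in e1.
have e2 := gbinom_rising (- nu) j m; rewrite -/n -/(pm j) -/(pm n) in e2.
have e3 : 'C(n, j)%:R * (j`!%:R * m`!%:R) = n`!%:R :> R.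
  by rewrite -!natrM -(@bin_fact n j) ?leq_addr // /n addKn.
rewrite prod_shift /jacobi_const -/(pp n) -/(pm n) -e1 -e2.
have -> : 'C(n, j)%:R = n`!%:R / (j`!%:R * m`!%:R) :> R.
  by rewrite -e3 mulfK // mulf_neq0.
field.
by rewrite n0 pp0 pm0 s0 !f0.
Qed.

(** At u = x the exponents (n - i - j) x + (i - j + nu) x no longer depend on i, so the sum over i
    is a number, evaluated by [sum_bin_inv] and matched with a product of binomials by
    [jacobi_coef]. *)
Lemma scaled_jacobi_primitive n (x : R) :
  scaled_jacobi nu n x = jacobi_const nu n * exp_primitive nu n x x.
Proof.
rewrite /scaled_jacobi (reindex_inj rev_ord_inj) /exp_primitive exchange_big
  mulr_sumr.
apply: eq_bigr => j _ /=.
have jn : (j <= n)%N by rewrite -ltnS.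
rewrite subSS subKn //; have em : (j + (n - j))%N = n by rewrite subnKC.
have := jacobi_coef j (n - j); rewrite em => <-.
have mE : (n - j)%:R = n%:R - j%:R :> R by rewrite natrB.
rewrite -mulrA; congr (_ * _).
rewrite -sum_bin_inv; last first.
  move=> i _; have -> : nu - j%:R + i%:R = i%:R - j%:R + nu by ring.
  exact: shift_neq0.
rewrite mulr_sumr mulr_suml; apply: eq_bigr => i _.
have -> : expR ((2 * (n - j)%:R - n%:R + nu) * x)
  = expR ((n%:R - i%:R - j%:R) * x) * expR ((i%:R - j%:R + nu) * x).
  by rewrite -expRD mE; congr expR; ring.
have -> : nu - j%:R + i%:R = i%:R - j%:R + nu by ring.
by rewrite exprD; ring.
Qed.
End scaled_jacobi_formula.

(** * Bounds for the kernel integrals *)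

Section wallis.
Variable R : realType.

(** The number beta_n, the integral of (1 - w^2)^n over [0, 1], given by its reduction formula. *)
Fixpoint wallis n : R :=
  if n is m.+1 then wallis m * ((2 * m%:R + 2) / (2 * m%:R + 3)) else 1.

(* [sqr_primitive n c] is the primitive of [w |-> (c ^+ 2 - w ^+ 2) ^+ n]
   vanishing at 0. *)
Fixpoint sqr_primitive n (c w : R) : R :=
  if n is m.+1 then (w * (c ^+ 2 - w ^+ 2) ^+ m.+1
      + (2 * m%:R + 2) * c ^+ 2 * sqr_primitive m c w) / (2 * m%:R + 3)
  else w.

Lemma wallis_gt0 n : 0 < wallis n.
Proof.
elim: n => [|n IH] /=; first exact: ltr01.
by rewrite mulr_gt0 // divr_gt0 // ltr_wpDl // mulr_ge0.
Qed.

(** The step is (2m + 2)^2 >= (2m + 1)(2m + 3). Although beta_n cancels from the main terms, this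
    lower bound is needed to absorb remainders that do not carry the factor beta_n. *)
Lemma wallis_sqr_ge n : 1 <= wallis n ^+ 2 * (2 * n%:R + 1).
Proof.
elim: n => [|n IH] /=; first by rewrite mulr0 add0r mulr1 expr1n.
apply: le_trans IH _; rewrite exprMn -[leRHS]mulrA ler_wpM2l ?sqr_ge0 //.
have n0 : 0 <= n%:R :> R by [].
rewrite -natr1 expr_div_n mulrAC ler_pdivlMr; first by nra.
by rewrite exprn_gt0 //; lra.
Qed.

Lemma wallis_le1 n : wallis n <= 1.
Proof.
elim: n => [|n IH] //=.
have n0 : 0 <= n%:R :> R by [].
apply: mulr_ile1 => //; first exact/ltW/wallis_gt0.
by rewrite ler_pdivrMr; lra.
Qed.

Lemma sqr_primitive0 n c : sqr_primitive n c 0 = 0.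
Proof. by elim: n => [|n IH] //=; rewrite IH mul0r mulr0 addr0 mul0r. Qed.

Lemma sqr_primitive_diag n c : sqr_primitive n c c = wallis n * c ^+ (2 * n).+1.
Proof.
elim: n => [|n IH] /=; first by rewrite mul1r.
rewrite subrr expr0n mulr0 add0r IH.
have -> : (2 * n.+1).+1 = ((2 * n).+1 + 2)%N by lia.
by rewrite exprD; ring.
Qed.

(** Integration by parts: the derivative of w (c^2 - w^2)^(m+1) is (2m + 3)(c^2 - w^2)^(m+1) - (2m +
    2) c^2 (c^2 - w^2)^m. *)
Lemma is_derive_sqr_primitive n (c w : R) :
  is_derive w 1 (sqr_primitive n c) ((c ^+ 2 - w ^+ 2) ^+ n).
Proof.
elim: n => [|n IH]; first exact: is_derive_id.
have d1 : is_derive w 1 (fun w => c ^+ 2 - w ^+ 2) (0 - 2 * w ^+ 1 * 1).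
  exact: is_derive_subf (is_derive_cst _ _ _)
    (is_derive_expn 1 (is_derive_id _ _)).
have d2 := is_derive_mulf (is_derive_id w (1 : R)) (is_derive_expn n d1).
have d3 := is_derive_cmul ((2 * n%:R + 2) * c ^+ 2) IH.
have e : (2 * n%:R + 3 : R) != 0.
  by rewrite gt_eqF // ltr_wpDl // mulr_ge0.
have := is_derive_cmul (2 * n%:R + 3)^-1 (is_derive_addf d2 d3).
under eq_fun do rewrite mulrC.
by move/is_derive_eq; apply; rewrite -(natr1 n) [(_ - _) ^+ n.+1]exprS; field.
Qed.
End wallis.

(** * Bounds for the exponential kernel *)

Section kernel_bounds.
Variables (R : realType) (n : nat).
Let nu : R := 1 / 6.

Lemma sixth_lt1 : 0 < `|nu| < 1.
Proof. by rewrite /nu ger0_norm; lra. Qed.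

Lemma sixthN_lt1 : 0 < `|- nu| < 1.
Proof. by rewrite normrN sixth_lt1. Qed.

(* Twice the hyperbolic cosine and sine of [x / 2]. *)
Definition ch (x : R) := expR (x / 2) + expR (- (x / 2)).
Definition sh (x : R) := expR (x / 2) - expR (- (x / 2)).

Lemma expR_half_sqr (x : R) : expR (x / 2) ^+ 2 = expR x.
Proof. by rewrite -expRM_natl; congr expR; field. Qed.

Lemma expR_half_sqrN (x : R) : expR (- (x / 2)) ^+ 2 = expR (- x).
Proof. by rewrite -expRM_natl; congr expR; field. Qed.

Lemma expR_half_mulN (x : R) : expR (x / 2) * expR (- (x / 2)) = 1.
Proof. by rewrite expRxMexpNx_1. Qed.

Lemma ch_sqr x : ch x ^+ 2 = expR x + expR (- x) + 2.
Proof.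
by rewrite /ch sqrrD expR_half_mulN expR_half_sqr expR_half_sqrN; ring.
Qed.

Lemma sh_sqr x : sh x ^+ 2 = expR x + expR (- x) - 2.
Proof.
by rewrite /sh sqrrB expR_half_mulN expR_half_sqr expR_half_sqrN; ring.
Qed.

Lemma ch_ge2 x : 2 <= ch x.
Proof.
have c0 : 0 < ch x by rewrite addr_gt0 // expR_gt0.
have : ch x ^+ 2 = sh x ^+ 2 + 4 by rewrite ch_sqr sh_sqr; ring.
by have := sqr_ge0 (sh x); nra.
Qed.

Lemma sh_ge0 x : 0 <= x -> 0 <= sh x.
Proof. by move=> x0; rewrite subr_ge0 ler_expR; lra. Qed.

Lemma exp_kernelE x u : exp_kernel x u = sh x ^+ 2 - sh u ^+ 2.
Proof. by rewrite /exp_kernel !sh_sqr; ring. Qed.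

Lemma cos_kernelE x t : cos_kernel x t = ch x ^+ 2 - (2 * sin (1 / 2 * t)) ^+ 2.
Proof.
rewrite /cos_kernel ch_sqr.
have -> : cos t = cos ((1 / 2 * t) *+ 2) by congr cos; field.
by rewrite cos_mulr2n exprMn sin2cos2; ring.
Qed.

Lemma is_derive_sh (u : R) : is_derive u 1 sh (ch u / 2).
Proof.
have d := is_derive_subf (is_derive_expR_lin (1 / 2) u)
  (is_derive_expR_lin (- (1 / 2)) u).
have -> : sh = (fun y => expR (1 / 2 * y) - expR (- (1 / 2) * y)).
  by apply/funext => y; rewrite /sh; congr (expR _ - expR _); field.
move/is_derive_eq: d; apply; rewrite /ch.
have -> : - (u / 2) = - (1 / 2) * u by field.
have -> : u / 2 = 1 / 2 * u by field.
by field.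
Qed.

Lemma exp_kernel_ge0 (x u : R) : 0 <= u <= x -> 0 <= exp_kernel x u.
Proof.
move=> /andP[u0 ux]; rewrite exp_kernelE subr_ge0 ler_pXn2r ?nnegrE ?sh_ge0 //.
  by rewrite lerB // ler_expR; lra.
exact: le_trans ux.
Qed.

Lemma exp_kernelN (x u : R) : exp_kernel x (- u) = exp_kernel x u.
Proof. by rewrite /exp_kernel opprK; ring. Qed.

Lemma exp_kernel_Nx (x u : R) : exp_kernel (- x) u = exp_kernel x u.
Proof. by rewrite /exp_kernel opprK; ring. Qed.

(** Adding the primitive for -nu cancels the value at u = 0, hence the cosine integral; what remains
    is the small difference y(x) - y(-x) up to the constant. *)
Definition odd_primitive (x u : R) := exp_primitive nu n x u
  + exp_primitive (- nu) n x u.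

Lemma is_derive_odd_primitive (x u : R) : is_derive u 1 (odd_primitive x)
  (exp_kernel x u ^+ n * (expR (nu * u) + expR (- (nu * u)))).
Proof.
have d := is_derive_addf (is_derive_exp_primitive n sixth_lt1 x u)
  (is_derive_exp_primitive n sixthN_lt1 x u).
by move/is_derive_eq: d; apply; rewrite mulNr mulrDr.
Qed.

Lemma exp_primitiveN0 x : exp_primitive (- nu) n x 0 = - exp_primitive nu n x 0.
Proof.
rewrite /exp_primitive exchange_big -sumrN; apply: eq_bigr => i _.
rewrite -sumrN; apply: eq_bigr => j _.
rewrite !mulr0 expR0 addnC.
have -> : n%:R - j%:R - i%:R = n%:R - i%:R - j%:R :> R by ring.
have -> : j%:R - i%:R - nu = - (i%:R - j%:R + nu) by ring.
by rewrite invrN; ring.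
Qed.

Lemma odd_primitive0 x : odd_primitive x 0 = 0.
Proof. by rewrite /odd_primitive exp_primitiveN0 subrr. Qed.

(* [cosh (u / 2) = 4 c ^ 3 - 3 c] for [c = cosh (u / 6)] *)
Lemma cosh_sixth_bounds u :
  2 <= expR (nu * u) + expR (- (nu * u)) <= ch u.
Proof.
set q := expR (nu * u); set q' := expR (- (nu * u)).
have qq : q * q' = 1 by rewrite expRxMexpNx_1.
have q0 : 0 < q by exact: expR_gt0.
have q'0 : 0 < q' by exact: expR_gt0.
have -> : ch u = q ^+ 3 + q' ^+ 3.
  by rewrite /ch /q /q' -!expRM_natl; congr (expR _ + expR _); rewrite /nu;
    field.
have s2 : 2 <= q + q' by have := sqr_ge0 (q - q'); nra.
rewrite s2 /=.
have -> : q ^+ 3 + q' ^+ 3 = (q + q') ^+ 3 - 3 * (q * q') * (q + q') by ring.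
rewrite qq; nra.
Qed.

Lemma is_derive_sqr_primitive_sh m x (u : R) :
  is_derive u 1 (fun v => sqr_primitive m (sh x) (sh v))
    (exp_kernel x u ^+ m * (ch u / 2)).
Proof.
rewrite exp_kernelE.
exact: is_derive_compf (is_derive_sqr_primitive _ _ _) (is_derive_sh _).
Qed.

Lemma sh0 : sh 0 = 0.
Proof. by rewrite /sh mul0r oppr0 subrr. Qed.

(** Replacing 2 cosh(u/6) by the larger [ch u] makes the integrand exact in w = sh u, because dw =
    (ch u / 2) du. *)
Lemma odd_primitive_le x : 0 <= x ->
  odd_primitive x x <= 2 * (wallis R n * sh x ^+ (2 * n).+1).
Proof.
move=> x0.
have := derive_increment_le x0 (is_derive_odd_primitive x)
  (fun u => is_derive_cmul 2 (is_derive_sqr_primitive_sh n x u)).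
rewrite odd_primitive0 sh0 sqr_primitive0 mulr0 !subr0 sqr_primitive_diag;
  apply.
move=> u ux; rewrite mulrCA ler_wpM2l ?exprn_ge0 ?exp_kernel_ge0 //.
by have /andP[_] := cosh_sixth_bounds u; lra.
Qed.

(** Here 2 cosh(u/6) >= 2 >= ch u (1 - sh u^2 / 8). Writing sh u^2 as sh x^2 minus the kernel leads
    to the primitives of order n and n + 1, and beta_(n+1) / beta_n = (2n + 2)/(2n + 3) leaves the
    stated correction. *)
Lemma odd_primitive_ge x : 0 <= x ->
  2 * (wallis R n * sh x ^+ (2 * n).+1) * (1 - sh x ^+ 2 / (8 * (2 * n%:R + 3)))
  <= odd_primitive x x.
Proof.
move=> x0.
have d (u : R) : is_derive u 1 (fun v => 2 * (sqr_primitive n (sh x) (sh v)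
   - 1 / 8 * (sh x ^+ 2 * sqr_primitive n (sh x) (sh v)
     - sqr_primitive n.+1 (sh x) (sh v))))
   (2 * (exp_kernel x u ^+ n * (ch u / 2) - 1 / 8
     * (sh x ^+ 2 * (exp_kernel x u ^+ n * (ch u / 2))
      - exp_kernel x u ^+ n.+1 * (ch u / 2)))).
  have D m := is_derive_sqr_primitive_sh m x u.
  exact: (is_derive_cmul 2 (is_derive_subf (D n) (is_derive_cmul (1 / 8)
    (is_derive_subf (is_derive_cmul (sh x ^+ 2) (D n)) (D n.+1))))).
have := derive_increment_le x0 d (is_derive_odd_primitive x).
rewrite odd_primitive0 sh0 !sqr_primitive0 !mulr0 subr0 !mulr0 !subr0 mulr0
  subr0.
rewrite !sqr_primitive_diag => H; apply: le_trans (H _) => {H} [|u ux].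
  have -> : (2 * n.+1).+1 = ((2 * n).+1 + 2)%N by lia.
  rewrite [wallis R n.+1]/= exprD le_eqVlt; apply/orP; left; apply/eqP; field.
  by rewrite gt_eqF // ltr_wpDl // mulr_ge0.
have k0 : 0 <= exp_kernel x u ^+ n by rewrite exprn_ge0 ?exp_kernel_ge0.
have -> : exp_kernel x u ^+ n.+1 = exp_kernel x u ^+ n
  * (sh x ^+ 2 - sh u ^+ 2).
  by rewrite exprSr -exp_kernelE.
have -> : 2 * (exp_kernel x u ^+ n * (ch u / 2) - 1 / 8
  * (sh x ^+ 2 * (exp_kernel x u ^+ n * (ch u / 2))
      - exp_kernel x u ^+ n * (sh x ^+ 2 - sh u ^+ 2) * (ch u / 2)))
   = exp_kernel x u ^+ n * (ch u * (1 - sh u ^+ 2 / 8)) by field.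
rewrite ler_wpM2l //.
have /andP[c2 _] := cosh_sixth_bounds u; apply: le_trans c2.
have -> : sh u ^+ 2 = ch u ^+ 2 - 4 by rewrite ch_sqr sh_sqr; ring.
have c2 := ch_ge2 u.
rewrite -subr_ge0.
have -> : 2 - ch u * (1 - (ch u ^+ 2 - 4) / 8) = (ch u - 2) ^+ 2
  * (ch u + 4) / 8 by field.
by rewrite divr_ge0 // mulr_ge0 ?sqr_ge0 //; lra.
Qed.
End kernel_bounds.

(** * Bounds for the cosine integral *)

Section cos_bounds.
Variables (R : realType) (n : nat).
Let nu : R := 1 / 6.
Let A x := cos_primitive nu n x pi.

Lemma pi_le4 : pi <= 4 :> R.
Proof. by have /andP[_] := (pihalf_02_cos_pihalf R).1; lra. Qed.

Lemma cos_kernel_ge0 (x t : R) : 0 <= cos_kernel x t.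
Proof.
have c2 := ch_ge2 x; have := ch_sqr x; have := cos_geN1 t.
by rewrite /cos_kernel; nra.
Qed.

Lemma cos_kernel_le (x t c : R) : cos t <= c -> cos_kernel x t <= ch x ^+ 2
  - 2 + 2 * c.
Proof. by have := ch_sqr x; rewrite /cos_kernel; lra. Qed.

(** The triple-angle formula at pi/6 gives a cubic with the double root 1/2 and the root -1,
    excluded by positivity. *)
Lemma sin_sixth : sin (nu * pi) = 1 / 2.
Proof.
have e : sin (pi / 2) = 3 * sin (nu * pi) - 4 * sin (nu * pi) ^+ 3.
  have -> : pi / 2 = nu * pi + (nu * pi) *+ 2 by rewrite /nu; field.
  rewrite sinD sin_mulr2n cos_mulr2n.
  have := cos2Dsin2 (nu * pi).
  set s := sin _; set c := cos _ => cs.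
  have -> : c ^+ 2 = 1 - s ^+ 2 by rewrite -cs; ring.
  have -> : c * ((c * s) *+ 2) = c ^+ 2 * s *+ 2 by ring.
  have -> : c ^+ 2 = 1 - s ^+ 2 by rewrite -cs; ring.
  by ring.
have s0 : 0 < sin (nu * pi).
  by apply: sin_gt0_pi; have := pi_gt0 R; rewrite /nu => p0; apply/andP; split;
    lra.
move: e; rewrite sin_pihalf; set s := sin _ in s0 *=> e.
have : (s + 1) * (2 * s - 1) ^+ 2 = 0
  by rewrite -[RHS](subrr 1) [X in _ = _ - X]e; ring.
move/eqP; rewrite mulf_eq0 sqrf_eq0 => /orP[|] /eqP; lra.
Qed.

Lemma cos_half_le_sixth (t : R) : 0 <= t <= pi -> cos (1 / 2 * t)
  <= cos (nu * t).
Proof.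
move=> /andP[t0 tpi].
rewrite leNgt ltr_cos ?in_itv /= -?leNgt; have := pi_gt0 R; rewrite /nu; lra.
Qed.

Lemma is_derive_sin_half (t : R) : is_derive t 1 (fun t => 2
  * sin (1 / 2 * t)) (cos (1 / 2 * t)).
Proof.
have := is_derive_cmul 2 (is_derive_sin_lin (1 / 2) t).
by move/is_derive_eq; apply; field.
Qed.

Lemma is_derive_sqr_primitive_sin m (x t : R) :
  is_derive t 1 (fun v => sqr_primitive m (ch x) (2 * sin (1 / 2 * v)))
    (cos_kernel x t ^+ m * cos (1 / 2 * t)).
Proof.
rewrite cos_kernelE.
exact: is_derive_compf (is_derive_sqr_primitive _ _ _) (is_derive_sin_half _).
Qed.

Lemma half_pi : 1 / 2 * pi = pi / 2 :> R.
Proof. by field. Qed.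

(** With cos(t/6) >= cos(t/2) the integrand becomes exact in w = 2 sin(t/2), which runs up to 2 as t
    reaches pi. *)
Lemma cos_primitive_ge x : sqr_primitive n (ch x) 2 <= A x.
Proof.
have p0 := ltW (pi_gt0 R).
have := derive_increment_le p0 (is_derive_sqr_primitive_sin n x)
  (is_derive_cos_primitive n (sixth_lt1 R) x).
rewrite cos_primitive0 mulr0 sin0 mulr0 sqr_primitive0 !subr0 half_pi
  sin_pihalf mulr1.
apply => t tp; rewrite ler_wpM2l ?exprn_ge0 ?cos_kernel_ge0 //.
exact: cos_half_le_sixth.
Qed.

Lemma cos_primitive_le_crude x : A x <= 4 * ch x ^+ (2 * n).
Proof.
have p0 := ltW (pi_gt0 R).
have := derive_increment_le p0 (is_derive_cos_primitive n (sixth_lt1 R) x)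
  (is_derive_lin (ch x ^+ (2 * n))).
rewrite cos_primitive0 mulr0 !subr0 => H.
apply: (le_trans (H _)) => {H} [t tp|]; last first.
  by rewrite mulrC ler_wpM2r ?pi_le4 // exprn_ge0 // (le_trans _ (ch_ge2 x)).
have k0 := cos_kernel_ge0 x t.
apply: (@le_trans _ _ (cos_kernel x t ^+ n * 1)).
  by rewrite ler_wpM2l ?exprn_ge0 ?cos_le1.
rewrite mulr1 exprM lerXn2r ?nnegrE ?sqr_ge0 //.
by have := cos_kernel_le x (cos_le1 t); lra.
Qed.

(* [1 <= cos (t / 2) + sin (t / 2) ^ 2], and on [0, pi / 2] the last term is at
   most [2 sin (t / 2) ^ 2 cos (t / 2)], which has an explicit primitive against
   [cos_kernel]; beyond [pi / 2] the kernel is small. *)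
Lemma cos_primitive_le x : A x <= wallis R n * ch x ^+ (2 * n).+1
     * (1 + ch x ^+ 2 / (2 * (2 * n%:R + 3))) + 2 * (ch x ^+ 2 - 2) ^+ n.
Proof.
have p0 := pi_gt0 R; have c2 := ch_ge2 x.
have q0 : 0 <= pi / 2 :> R by lra.
have q1 : pi / 2 <= pi :> R by lra.
pose J m w := sqr_primitive m (ch x) w.
(* A primitive of (ch x^2 - w^2)^n (1 + w^2 / 2), vanishing at 0; at w = 2 sin(t/2) the second
   factor is 1 + 2 sin(t/2)^2. *)
pose K w := J n w + 1 / 2 * (ch x ^+ 2 * J n w - J n.+1 w).
have dK (w : R) : is_derive w 1 K ((ch x ^+ 2 - w ^+ 2) ^+ n
  * (1 + w ^+ 2 / 2)).
  have D m := is_derive_sqr_primitive m (ch x) w.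
  have d := is_derive_addf (D n) (is_derive_cmul (1 / 2)
    (is_derive_subf (is_derive_cmul (ch x ^+ 2) (D n)) (D n.+1))).
  by move/is_derive_eq: d; apply; rewrite [_ ^+ n.+1]exprSr; field.
have K0 : K 0 = 0 by rewrite /K /J !sqr_primitive0; ring.
have dKs (t : R) : is_derive t 1 (fun t => K (2 * sin (1 / 2 * t)))
   (cos_kernel x t ^+ n * (1 + (2 * sin (1 / 2 * t)) ^+ 2 / 2)
     * cos (1 / 2 * t)).
  by rewrite cos_kernelE; exact: is_derive_compf (dK _) (is_derive_sin_half _).
have near0 : cos_primitive nu n x (pi / 2) <= K (2 * sin (1 / 2 * (pi / 2))).
  have := derive_increment_le q0 (is_derive_cos_primitive n (sixth_lt1 R) x)
    dKs.
  rewrite cos_primitive0 mulr0 sin0 mulr0 K0 !subr0; apply => t /andP[t0 t1].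
  rewrite -mulrA ler_wpM2l ?exprn_ge0 ?cos_kernel_ge0 //.
  apply: le_trans (cos_le1 _) _.
  have c0 : 0 <= cos (1 / 2 * t) by apply: cos_ge0_pihalf; lra.
  have ct : 0 <= cos t by apply: cos_ge0_pihalf; lra.
  have : cos t = 2 * cos (1 / 2 * t) ^+ 2 - 1.
    have -> : cos t = cos ((1 / 2 * t) *+ 2) by congr cos; field.
    by rewrite cos_mulr2n; ring.
  move: ct; rewrite exprMn sin2cos2; set c := cos (1 / 2 * t) in c0 *.
  have c1 : c <= 1 by exact: cos_le1.
  set c' := cos t => ct e.
  rewrite -subr_ge0; have -> : (1 + 2 ^+ 2 * (1 - c ^+ 2) / 2) * c - 1
    = (1 - c) * (c' + 2 * c) by rewrite e; field.
  by rewrite mulr_ge0; lra.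
(* Monotonicity of [K] moves the endpoint 2 sin(pi/4) up to [ch x], where [K] is explicit. *)
have Kle (w : R) : w <= ch x -> 0 <= w -> K w <= K (ch x).
  move=> wc w0; have := derive_increment_le wc (fun y =>
    is_derive_cst (0 : R) y 1) dK.
  rewrite /cst subrr subr_ge0; apply => y /andP[wy yc].
  rewrite mulr_ge0 // ?exprn_ge0 //; nra.
have far : A x - cos_primitive nu n x (pi / 2) <= 2 * (ch x ^+ 2 - 2) ^+ n.
  have := derive_increment_le q1 (is_derive_cos_primitive n (sixth_lt1 R) x)
    (is_derive_lin ((ch x ^+ 2 - 2) ^+ n)).
  have e0 : 0 <= ch x ^+ 2 - 2 by nra.
  move=> H; apply: (le_trans (H _)) => {H} [t /andP[t0 t1]|]; last first.
    rewrite -mulrBr mulrC ler_wpM2r ?exprn_ge0 //; have := pi_le4; lra.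
  have k0 := cos_kernel_ge0 x t.
  apply: (@le_trans _ _ (cos_kernel x t ^+ n * 1)).
    by rewrite ler_wpM2l ?exprn_ge0 ?cos_le1.
  rewrite mulr1 lerXn2r ?nnegrE //.
  have := @cos_kernel_le x t 0; rewrite mulr0 addr0; apply.
  rewrite -(subrK (pi / 2) t) cosDpihalf oppr_le0.
  have tp : 0 <= t - pi / 2 <= pi by apply/andP; split; lra.
  exact: sin_ge0_pi tp.
have s0 : 0 <= sin (1 / 2 * (pi / 2) : R) by apply: sin_ge0_pi; lra.
have s1 := sin_le1 (1 / 2 * (pi / 2) : R).
have KL : K (2 * sin (1 / 2 * (pi / 2))) <= K (ch x) by apply: Kle; lra.
have -> : wallis R n * ch x ^+ (2 * n).+1
  * (1 + ch x ^+ 2 / (2 * (2 * n%:R + 3))) = K (ch x).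
  rewrite /K /J !sqr_primitive_diag.
  have -> : (2 * n.+1).+1 = ((2 * n).+1 + 2)%N by lia.
  rewrite [wallis R n.+1]/= exprD; field.
  by rewrite gt_eqF // ltr_wpDl // mulr_ge0.
lra.
Qed.
End cos_bounds.

(** * Size of the scaled Jacobi-type sum *)

Section scaled_jacobi_bounds.
Variables (R : realType) (n : nat).
Let nu : R := 1 / 6.
Let g := jacobi_const nu n.
Let y := scaled_jacobi nu n.
Let N (x : R) := wallis R n * ch x ^+ (2 * n).+1.

Lemma jacobi_const_gt0 : 0 < g.
Proof.
have pos (mu : R) : `|mu| < 1 -> 0 < \prod_(i < n) (i.+1%:R + mu).
  move=> mu1; apply: prodr_gt0 => i _.
  have : (1 : R) <= i.+1%:R by rewrite ler1n.
  by move: mu1; rewrite ltr_norml => /andP[+ _]; lra.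
have := sixth_lt1 R => /andP[_ n1].
rewrite /g /jacobi_const divr_gt0 ?exprn_gt0 ?ltr0n ?fact_gt0 //.
rewrite mulr_gt0 ?pos ?normrN // mulr_gt0 ?pos //.
by rewrite /nu; lra.
Qed.

Lemma gbinom_ge0 (x : R) k : k%:R <= x + 1 -> 0 <= gbinom x k.
Proof.
move=> kx; rewrite divr_ge0 // prodr_ge0 // => i _.
have : (i.+1%:R : R) <= k%:R by rewrite ler_nat.
by rewrite -natr1; lra.
Qed.

Lemma scaled_jacobi_ge0 x : 0 <= y x.
Proof.
apply: sumr_ge0 => k _; have kn : (k <= n)%N by rewrite -ltnS.
have k1 : (k%:R : R) <= n%:R by rewrite ler_nat.
have k2 : ((n - k)%:R : R) <= n%:R by rewrite ler_nat leq_subr.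
have a1 : 0 <= gbinom (n%:R - nu) k by apply: gbinom_ge0; rewrite /nu; lra.
have a2 : 0 <= gbinom (n%:R + nu) (n - k) by apply: gbinom_ge0; rewrite /nu;
  lra.
exact: mulr_ge0 (mulr_ge0 a1 a2) (expR_ge0 _).
Qed.

Lemma scaled_jacobiN x : y (- x) = scaled_jacobi (- nu) n x.
Proof.
rewrite /y /scaled_jacobi (reindex_inj rev_ord_inj); apply: eq_bigr => k _ /=.
have kn : (k <= n)%N by rewrite -ltnS.
rewrite subSS subKn // natrB // opprK [X in X * _]mulrC; congr (_ * expR _).
by ring.
Qed.

Lemma jacobi_constN : jacobi_const (- nu) n = - g.
Proof. by rewrite /g /jacobi_const opprK; ring. Qed.

Lemma scaled_jacobi_odd x : y x - y (- x) = g * odd_primitive n x x.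
Proof.
rewrite scaled_jacobiN /y !scaled_jacobi_primitive ?sixth_lt1 ?sixthN_lt1 //
  jacobi_constN -/g.
by rewrite /odd_primitive -/nu; ring.
Qed.

Lemma scaled_jacobiE x : y x = g * (2 * cos_primitive nu n x pi
  + (exp_primitive nu n x x - exp_primitive nu n x 0)).
Proof.
rewrite /y scaled_jacobi_primitive ?sixth_lt1 //
  -/g cos_primitive_pi sin_sixth -/nu.
by field.
Qed.

(** For x <= 0 the exponential increment in [scaled_jacobiE] is negative and may be dropped. *)
Lemma scaled_jacobi_le_crude x : x <= 0 -> y x <= 8 * g * ch x ^+ (2 * n).
Proof.
move=> x0; have := cos_primitive_le_crude n x; rewrite scaled_jacobiE -/nu =>
  HA.
have d u := is_derive_exp_primitive n (sixth_lt1 R) x u.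
have := derive_increment_le x0 (fun u => is_derive_cst (0 : R) u 1) d.
rewrite /cst subrr => H.
have {}H : 0 <= exp_primitive nu n x 0 - exp_primitive nu n x x.
  apply: H => u /andP[u1 u2]; rewrite mulr_ge0 ?expR_ge0 // exprn_ge0 //.
  by rewrite -exp_kernelN -exp_kernel_Nx exp_kernel_ge0 //; lra.
have := jacobi_const_gt0 => g0.
have -> : 8 * g * ch x ^+ (2 * n) = g * (2 * (4 * ch x ^+ (2 * n))) by ring.
by rewrite ler_pM2l //; lra.
Qed.

Lemma exp_increment_bounds x : 0 <= x ->
  0 <= exp_primitive nu n x x - exp_primitive nu n x 0
    <= 2 * (wallis R n * sh x ^+ (2 * n).+1).
Proof.
move=> x0.
have d u := is_derive_exp_primitive n (sixth_lt1 R) x u.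
apply/andP; split.
  have := derive_increment_le x0 (fun u => is_derive_cst (0 : R) u 1) d.
  rewrite /cst subrr; apply => u ux.
  by rewrite mulr_ge0 ?expR_ge0 // exprn_ge0 // exp_kernel_ge0.
have := derive_increment_le x0 d (fun u =>
  is_derive_cmul 2 (is_derive_sqr_primitive_sh n x u)).
rewrite sh0 sqr_primitive0 mulr0 subr0 sqr_primitive_diag; apply => u ux.
rewrite mulrCA ler_wpM2l ?exprn_ge0 ?exp_kernel_ge0 //.
have /andP[_] := cosh_sixth_bounds u; have := expR_gt0 (- (nu * u)).
by rewrite -/nu; lra.
Qed.

Lemma pow_sub_le (c a : R) : 0 < c -> a <= c ->
  (c - a) ^+ n <= c ^+ n * expR (- (n%:R * (a / c))).
Proof.
move=> c0 ac.
have -> : c - a = c * (1 - a / c) by field; rewrite gt_eqF.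
rewrite exprMn ler_pM2l ?exprn_gt0 //
  -(mulrN n%:R) expRM_natl lerXn2r ?nnegrE ?expR_ge0 //.
  by rewrite subr_ge0 ler_pdivrMr // mul1r.
exact: expR_ge1Dx.
Qed.

Hypothesis n_gt0 : (0 < n)%N.

Let nR : (1 : R) <= n%:R.
Proof. by rewrite ler1n. Qed.

Lemma wallis_sqr_ge3 : 1 <= 3 * n%:R * wallis R n ^+ 2.
Proof. by have := wallis_sqr_ge R n; have := sqr_ge0 (wallis R n); have := nR;
  nra. Qed.

Lemma scaled_jacobi_main_gt0 x : 0 < N x.
Proof.
by rewrite mulr_gt0 ?wallis_gt0 // exprn_gt0 // (lt_le_trans _ (ch_ge2 x)).
Qed.

(** Controls the part of the cosine integral beyond pi/2. With L = ch x it suffices that e^(-2n/L^2)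
    <= beta_n L^3 / n; after squaring this follows from e^(-v) <= 6 / v^3 at v = 4n/L^2 and beta_n^2
    >= 1/(3n). *)
Lemma sub2_pow_le x : (ch x ^+ 2 - 2) ^+ n <= N x * (ch x ^+ 2 / n%:R).
Proof.
have c2 := ch_ge2 x; set L := ch x in c2 *; have L0 : 0 < L by lra.
have w0 := wallis_gt0 R n; have n1 := nR; have nz : 0 < n%:R :> R by lra.
apply: le_trans (pow_sub_le _ _) _; [nra|nra|].
rewrite -exprM /N -/L [L ^+ (2 * n).+1]exprSr.
have -> : wallis R n * (L ^+ (2 * n) * L) * (L ^+ 2 / n%:R)
   = L ^+ (2 * n) * (wallis R n * L ^+ 3 / n%:R) by field; rewrite gt_eqF.
rewrite ler_pM2l ?exprn_gt0 // -(@ler_pXn2r _ 2) ?nnegrE ?expR_ge0 //;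
  last first.
  by rewrite divr_ge0 ?(ltW nz) // mulr_ge0 ?(ltW w0) // exprn_ge0 // ltW.
rewrite -expRM_natl.
set v := 2 * (n%:R * (2 / L ^+ 2)).
have -> : 2 * - (n%:R * (2 / L ^+ 2)) = - v by rewrite /v; ring.
have v0 : 0 < v by rewrite /v !mulr_gt0 ?invr_gt0 ?exprn_gt0.
have e3 := expR_ge1Dxn 2 (ltW v0).
have vL : v * L ^+ 2 = 4 * n%:R by rewrite /v; field; rewrite gt_eqF.
rewrite expRN -[leLHS]mul1r ler_pdivrMr ?expR_gt0 //.
apply: (@le_trans _ _ ((wallis R n * L ^+ 3 / n%:R) ^+ 2 * (v ^+ 3 / 3`!%:R)));
  last first.
  by rewrite ler_wpM2l ?sqr_ge0 // (le_trans _ e3) // lerDr.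
have -> : (wallis R n * L ^+ 3 / n%:R) ^+ 2 * (v ^+ 3 / 3`!%:R)
   = wallis R n ^+ 2 * (v * L ^+ 2) ^+ 3 / n%:R ^+ 2 / 6.
  by rewrite (_ : 3`!%:R = 6); [field; rewrite gt_eqF | ].
rewrite vL.
have -> : wallis R n ^+ 2 * (4 * n%:R) ^+ 3 / n%:R ^+ 2 / 6
   = (3 * n%:R * wallis R n ^+ 2) * (32 / 9) by field; rewrite gt_eqF.
by have := wallis_sqr_ge3; lra.
Qed.

(** Shows that the exponential increment is only an error term: (1 - 4/L^2)^n <= e^(-4n/L^2) <=
    L^2/(4n) for L = ch x. *)
Lemma sh_pow_le x : 0 <= x ->
  wallis R n * sh x ^+ (2 * n).+1 <= N x * (ch x ^+ 2 / (4 * n%:R)).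
Proof.
move=> x0; have c2 := ch_ge2 x; have s0 := sh_ge0 x0; have w0 := wallis_gt0 R n.
have n1 := nR; have nz : 0 < n%:R :> R by lra.
rewrite -mulrA ler_pM2l // [sh x ^+ _]exprSr exprM.
have sc : sh x <= ch x by rewrite /sh /ch; have := expR_gt0 (- (x / 2)); lra.
have -> : sh x ^+ 2 = ch x ^+ 2 - 4 by rewrite ch_sqr sh_sqr; ring.
set L := ch x in c2 sc *; have L0 : 0 < L by lra.
rewrite [L ^+ (2 * n).+1]exprSr mulrAC ler_pM ?exprn_ge0 //; first by nra.
apply: le_trans (pow_sub_le _ _) _; [nra|nra|].
rewrite exprM ler_pM2l ?exprn_gt0 ?exprn_gt0 //.
set v := n%:R * (4 / L ^+ 2).
have v0 : 0 < v by rewrite /v !mulr_gt0 ?invr_gt0 ?exprn_gt0.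
have -> : L ^+ 2 / (4 * n%:R) = v^-1.
  by rewrite /v; field; rewrite !gt_eqF.
rewrite expRN lef_pV2 ?posrE ?expR_gt0 //.
by have := expR_ge1Dx v; lra.
Qed.

Lemma sub4_pow_le x : (ch x ^+ 2 - 4) ^+ n.+1 / (4 * n.+1%:R)
   <= N x * (ch x ^+ 2 / (4 * n%:R)).
Proof.
have c2 := ch_ge2 x; set L := ch x in c2 *; have L0 : 0 < L by lra.
have w0 := wallis_gt0 R n; have n1 := nR; have nz : 0 < n%:R :> R by lra.
have H : (L ^+ 2 - 4) ^+ n.+1 <= N x * L ^+ 2.
  rewrite exprSr /N -/L ler_pM ?exprn_ge0 //; [nra|nra| |nra].
  apply: le_trans (pow_sub_le _ _) _; [nra|nra|].
  rewrite -exprM [L ^+ (2 * n).+1]exprSr [leRHS]mulrCA ler_pM2l ?exprn_gt0 //.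
  rewrite -(@ler_pXn2r _ 2) ?nnegrE ?expR_ge0 ?mulr_ge0 ?(ltW w0) ?(ltW L0) //.
  rewrite -expRM_natl.
  set v := 2 * (n%:R * (4 / L ^+ 2)).
  have -> : 2 * - (n%:R * (4 / L ^+ 2)) = - v by rewrite /v; ring.
  have v0 : 0 < v by rewrite /v !mulr_gt0 ?invr_gt0 ?exprn_gt0.
  have vL : v * L ^+ 2 = 8 * n%:R by rewrite /v; field; rewrite gt_eqF.
  rewrite expRN -[leLHS]mul1r ler_pdivrMr ?expR_gt0 //.
  apply: (@le_trans _ _ ((wallis R n * L) ^+ 2 * v)); last first.
    by rewrite ler_wpM2l ?sqr_ge0 //; have := expR_ge1Dx v; lra.
  rewrite exprMn -mulrA [L ^+ 2 * v]mulrC vL.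
  by have := wallis_sqr_ge3; lra.
rewrite mulrA ler_pM ?invr_ge0 //.
- by rewrite exprn_ge0 //; nra.
- by rewrite lef_pV2 ?posrE ?mulr_gt0 ?ltr0n // ler_pM2l // ler_nat.
Qed.

(** [cos_primitive_ge] stops at w = 2 instead of w = ch x. On the missing piece the factor w/2 >= 1
    may be inserted, which makes the integrand exact, and [sub4_pow_le] bounds the result. *)
Lemma cos_primitive_ge_main x : N x * (1 - ch x ^+ 2 / (4 * n%:R))
  <= cos_primitive nu n x pi.
Proof.
apply: le_trans (cos_primitive_ge n x).
have := derive_increment_le (ch_ge2 x)
  (fun w => is_derive_sqr_primitive n (ch x) w).
set J := sqr_primitive n (ch x).
have d (w : R) : is_derive w 1 (fun w => - (4 * n.+1%:R)^-1
  * (ch x ^+ 2 - w ^+ 2) ^+ n.+1)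
   ((ch x ^+ 2 - w ^+ 2) ^+ n * (w / 2)).
  have d1 : is_derive w 1 (fun w => ch x ^+ 2 - w ^+ 2) (0 - 2 * w ^+ 1 * 1).
    exact: is_derive_subf (is_derive_cst _ _ _)
      (is_derive_expn 1 (is_derive_id _ _)).
  have d2 := is_derive_cmul (- (4 * n.+1%:R)^-1) (is_derive_expn n d1).
  by move/is_derive_eq: d2; apply; field; rewrite nat1r pnatr_eq0.
move/(_ _ _ d) => H.
have e : N x = J (ch x) by rewrite /J sqr_primitive_diag.
have T := sub4_pow_le x.
have {}H : J (ch x) - J 2 <= (ch x ^+ 2 - 4) ^+ n.+1 / (4 * n.+1%:R).
  apply: (le_trans (H _)) => [w /andP[w2 wc]|].
    rewrite -[leLHS]mulr1 ler_wpM2l ?exprn_ge0 //; [nra|lra].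
  rewrite subrr expr0n mulr0 sub0r mulNr opprK mulrC.
  by have -> : (2 : R) ^+ 2 = 4 by ring.
rewrite mulrBr mulr1 lerBlDr -lerBlDl {1}e.
exact: le_trans H T.
Qed.

(** In units of g N q, with q = ch x^2 / n, the excess is at most 5: 1/2 and 4 from the two
    corrections in [cos_primitive_le] and 1/2 from the exponential increment. The deficit is at most
    1/2, and the statement allows 6. *)
Lemma scaled_jacobi_approx x : 0 <= x ->
  `|y x - 2 * g * N x| <= 2 * g * N x * (3 * ch x ^+ 2 / n%:R).
Proof.
move=> x0; have g0 := jacobi_const_gt0; have n0 := scaled_jacobi_main_gt0 x.
have n1 := nR; have nz : 0 < n%:R :> R by lra.
have /andP[E0 E1] := exp_increment_bounds x0.
have s := sh_pow_le x0; have m := sub2_pow_le x;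
  have a0 := cos_primitive_ge_main x.
have a1 := cos_primitive_le n x; rewrite -/nu -/(N x) in a1.
rewrite scaled_jacobiE; set a := cos_primitive _ _ _ _ in a0 a1 *.
set E := exp_primitive _ _ _ _ - _ in E0 E1 *.
have L2 : 0 <= ch x ^+ 2 by rewrite sqr_ge0.
have q0 : 0 <= ch x ^+ 2 / n%:R by rewrite divr_ge0.
have q1 : ch x ^+ 2 / (2 * (2 * n%:R + 3)) <= ch x ^+ 2 / n%:R / 4.
  rewrite -mulrA -invfM ler_wpM2l // lef_pV2 ?posrE; lra.
have q2 : ch x ^+ 2 / (4 * n%:R) = ch x ^+ 2 / n%:R / 4 by field;
  rewrite gt_eqF.
have -> : 3 * ch x ^+ 2 / n%:R = 3 * (ch x ^+ 2 / n%:R) by rewrite mulrA.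
rewrite q2 in a0 s.
have {}a1 : a <= N x * (1 + ch x ^+ 2 / n%:R / 4) + 2 * (ch x ^+ 2 - 2) ^+ n.
  by apply: le_trans a1 _; rewrite lerD2r ler_pM2l // lerD2l.
set q := ch x ^+ 2 / n%:R in q0 q1 a0 a1 s m *.
have Nq : 0 <= N x * q by rewrite mulr_ge0 // ltW.
have -> : g * (2 * a + E) - 2 * g * N x = g * (2 * a + E - 2 * N x) by ring.
have -> : 2 * g * N x * (3 * q) = g * (6 * (N x * q)) by ring.
rewrite normrM gtr0_norm // ler_pM2l // ler_norml; apply/andP; split; lra.
Qed.
End scaled_jacobi_bounds.

(** * Moments of the Gamma function *)

Section positive_half_line.
Variable R : realType.
Notation mu := (@lebesgue_measure R).

(* The parameter [p] is there because squaring maps [exhaust 0 k] onto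
   [exhaust 1 k]. *)
Definition exhaust (p k : nat) : set R := `[(k.+1%:R ^+ p.+1)^-1,
  k.+1%:R ^+ p.+1].

Lemma exhaust_gt0 p k (x : R) : exhaust p k x -> 0 < x.
Proof.
rewrite /exhaust /= in_itv /= => /andP[+ _]; apply: lt_le_trans.
by rewrite invr_gt0 exprn_gt0.
Qed.

Lemma exhaust_le (k : nat) : (k.+1%:R ^+ 1)^-1 <= k.+1%:R ^+ 1 :> R.
Proof.
rewrite expr1; apply: (@le_trans _ _ 1); first by rewrite invf_le1 // ler1n.
by rewrite ler1n.
Qed.

Lemma exhaust_nondecreasing p : nondecreasing_seq (exhaust p).
Proof.
move=> k l kl; rewrite subsetEset; apply: subset_itv; rewrite bnd_simp.
  by rewrite lef_pV2 ?posrE ?exprn_gt0 // lerXn2r ?nnegrE // ler_nat ltnS.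
by rewrite lerXn2r ?nnegrE // ler_nat ltnS.
Qed.

Lemma exhaust_bigcup p : \bigcup_k exhaust p k = `]0, +oo[%classic.
Proof.
apply/seteqP; split => x /=; first by move=> [k _ /exhaust_gt0];
  rewrite in_itv /= andbT.
rewrite in_itv /= andbT => x0.
pose m := Num.max x x^-1.
have [k km] : exists k : nat, m <= k.+1%:R.
  exists (Num.truncn m); apply: ltW; apply: truncnS_gt.
have k1 : k.+1%:R <= k.+1%:R ^+ p.+1 :> R.
  by rewrite exprS ler_peMr // exprn_ege1 // ler1n.
have /andP[mx mx'] : (x <= m) && (x^-1 <= m) by rewrite !le_max !lexx orbT.
exists k => //; rewrite /exhaust /= in_itv /=; apply/andP; split.
  rewrite -[x]invrK lef_pV2 ?posrE ?invr_gt0 ?exprn_gt0 //.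
  by rewrite (le_trans mx') // (le_trans km).
by rewrite (le_trans mx) // (le_trans km).
Qed.

Lemma exhaust_cvg p (f : R -> R) : measurable_fun setT f ->
  (forall x, 0 < x -> 0 <= f x) ->
  (\int[mu]_(x in exhaust p k) (f x)%:E @[k --> \oo]
    --> \int[mu]_(x in `]0%R, +oo[) (f x)%:E)%E.
Proof.
move=> mf f0; rewrite -(exhaust_bigcup p).
apply: ge0_nondecreasing_set_cvg_integral.
- exact: exhaust_nondecreasing.
- by move=> i; exact: measurable_itv.
- by move=> i; apply/measurable_EFinP/measurable_funTS.
- by move=> i x /exhaust_gt0 /f0; rewrite lee_fin.
Qed.

Lemma pos_continuous_within (f : R -> R) (a b : R) : 0 < a ->
  (forall x, 0 < x -> {for x, continuous f}) -> {within `[a, b], continuous f}.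
Proof.
move=> a0 cf; apply: continuous_in_subspaceT => x.
by rewrite inE /= in_itv /= => /andP[ax _]; apply: cf; exact: lt_le_trans ax.
Qed.

Lemma pos_derivable_LR (F f : R -> R) (a b : R) : 0 < a -> a < b ->
  (forall x : R, 0 < x -> is_derive x 1 F (f x)) ->
    derivable_oo_LRcontinuous F a b.
Proof.
move=> a0 ab dF.
have cF (x : R) : 0 < x -> {for x, continuous F}.
  move=> x0; have [dd _] := dF x x0.
  by apply: differentiable_continuous; exact/derivable1_diffP.
split.
- move=> x; rewrite in_itv /= => /andP[ax _].
  by have [] := dF x (lt_trans a0 ax).
- by apply: cvg_at_right_filter; exact: cF.
- by apply: cvg_at_left_filter; apply: cF; exact: lt_trans ab.
Qed.

Lemma pos_FTC (F f : R -> R) (a b : R) : 0 < a -> a <= b ->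
  (forall x : R, 0 < x -> is_derive x 1 F (f x)) ->
  (forall x, 0 < x -> {for x, continuous f}) ->
  (\int[mu]_(x in `[a, b]) (f x)%:E = (F b - F a)%:E)%E.
Proof.
rewrite le_eqVlt => a0 /predU1P[-> _ _|ab dF cf].
  by rewrite set_itv1 integral_set1 subrr.
rewrite EFinB; apply: continuous_FTC2 => //.
- exact: pos_continuous_within.
- exact: pos_derivable_LR dF.
- move=> x; rewrite in_itv /= => /andP[ax _].
  by have [_ <-] := dF x (lt_trans a0 ax); rewrite derive1E.
Qed.

(** The substitution is made on compact intervals away from 0, and both sides are limits by monotone
    convergence. *)
Lemma integral_sqr_substitution (f : R -> R) : measurable_fun setT f ->
  (forall x, 0 < x -> 0 <= f x) -> (forall x, 0 < x -> {for x, continuous f}) ->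
  (\int[mu]_(x in `]0%R, +oo[) (f x)%:E
   = \int[mu]_(x in `]0%R, +oo[) (f (x ^+ 2) * (2 * x))%:E)%E.
Proof.
move=> mf f0 cf.
have c1 := @exhaust_cvg 1 f mf f0.
have c0 : (\int[mu]_(x in exhaust 0 k) (f (x ^+ 2) * (2 * x))%:E @[k --> \oo]
    --> \int[mu]_(x in `]0%R, +oo[) (f (x ^+ 2) * (2 * x))%:E)%E.
  apply: exhaust_cvg.
    apply: measurable_funM; last exact: mulrl_measurable.
    by apply: measurableT_comp => //; exact: exprn_measurable.
  by move=> x x0; rewrite !mulr_ge0 ?f0 ?exprn_gt0 // ltW.
suff e : (fun k => \int[mu]_(x in exhaust 1 k) (f x)%:E)%E
    = (fun k => \int[mu]_(x in exhaust 0 k) (f (x ^+ 2) * (2 * x))%:E)%E.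
  by rewrite e in c1; exact: cvg_unique c1 c0.
apply/funext => k.
pose F (x : R) := x ^+ 2.
have dF (x : R) : is_derive x 1 F (2 * x).
  have := is_derive_expn 1 (is_derive_id x (1 : R)).
  by move/is_derive_eq; apply; rewrite expr1 mulr1.
have F' : derive1 F = *%R 2 by apply/funext => x; rewrite derive1E;
  case: (dF x).
have a0 : 0 < (k.+1%:R ^+ 1)^-1 :> R by rewrite invr_gt0 exprn_gt0.
have c2 : continuous ( *%R 2 : R -> R) by exact: mulrl_continuous.
have := @integration_by_substitution_increasing R F f (k.+1%:R ^+ 1)^-1
  (k.+1%:R ^+ 1).
have -> : F (k.+1%:R ^+ 1)^-1 = (k.+1%:R ^+ 2)^-1 by rewrite /F exprVn.
have -> : F (k.+1%:R ^+ 1) = k.+1%:R ^+ 2 by [].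
rewrite F' => -> //.
- exact: exhaust_le.
- move=> x y; rewrite !in_itv /= => /andP[x0 _] /andP[y0 _] xy.
  by rewrite /F ltrXn2r // ?nnegrE ltW // (lt_le_trans a0).
- exact: cvgP (cvg_at_right_filter (c2 _)).
- exact: cvgP (cvg_at_left_filter (c2 _)).
- have cF (x : R) : {for x, continuous F}.
    have [dd _] := dF x.
    by apply: differentiable_continuous; exact/derivable1_diffP.
  split; [by move=> x _; case: (dF x)|by apply: cvg_at_right_filter;
    exact: cF|].
  by apply: cvg_at_left_filter; exact: cF.
- by apply: pos_continuous_within => //; rewrite invr_gt0 exprn_gt0.
Qed.
End positive_half_line.

(** * Euler's integral and its functional equation *)

Section gamma_moments.
Variable R : realType.
Notation mu := (@lebesgue_measure R).

(** Euler's integrand for t > 0, written as one exponential so that shifting the parameter and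
    differentiating happen in the exponent. *)
Definition gamma_kernel (a t : R) : R := expR ((a - 1) * ln t - t).

Lemma gamma_kernel_ge0 a t : 0 <= gamma_kernel a t.
Proof. exact: expR_ge0. Qed.

Lemma measurable_gamma_kernel a : measurable_fun setT (gamma_kernel a).
Proof.
apply: measurableT_comp => //; apply: measurable_funB => //.
by apply: measurable_funM => //; exact: measurable_ln.
Qed.

Lemma is_derive_pow_exp (a x : R) : 0 < x ->
  is_derive x 1 (fun t => expR (a * ln t - t))
    (a * gamma_kernel a x - gamma_kernel (a + 1) x).
Proof.
move=> x0; have d := is_derive1_ln x0.
have d1 := is_derive_subf (is_derive_cmul a d) (is_derive_id x (1 : R)).
have := is_derive_compf (is_derive_expR _) d1.
move/is_derive_eq; apply; rewrite /gamma_kernel addrK.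
have -> : expR ((a - 1) * ln x - x) = expR (a * ln x - x) / x.
  have e : x = expR (ln x) by rewrite lnK.
  by rewrite [X in _ = _ / X]e -expRB; congr expR; ring.
by field; rewrite gt_eqF.
Qed.

Lemma continuous_gamma_kernel a x : 0 < x ->
  {for x, continuous (gamma_kernel a)}.
Proof.
move=> x0; have [dd _] := is_derive_pow_exp (a - 1) x0.
by apply: differentiable_continuous; exact/derivable1_diffP.
Qed.

(** For a <= 1 one has e^(-t) <= 4/(1 + t)^2 <= 4/(1 + t)^(a+1). The majorant 4 t^(a-1)/(1 +
    t)^(a+1) has the primitive [G], which is (4/a)(t/(1 + t))^a and stays below 4/a. *)
Lemma gamma_kernel_finite a : 0 < a <= 1 ->
  (\int[mu]_(t in `]0%R, +oo[) (gamma_kernel a t)%:E < +oo)%E.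
Proof.
move=> /andP[a0 a1].
have c := @exhaust_cvg R 0 _ (measurable_gamma_kernel a)
  (fun x _ => gamma_kernel_ge0 a x).
suff b k : (\int[mu]_(t in @exhaust R 0 k) (gamma_kernel a t)%:E
  <= (4 / a)%:E)%E.
  apply: (@le_lt_trans _ _ (4 / a)%:E); last exact: ltry.
  by apply: cvge_to_le c _; apply: nearW => k; exact: b.
pose G (t : R) := 4 / a * expR (a * (ln t - ln (1 + t))).
pose G' (t : R) := 4 * (expR (a * (ln t - ln (1 + t))) / (t * (1 + t))).
have dG (t : R) : 0 < t -> is_derive t 1 G (G' t).
  move=> t0; have t1 : 0 < 1 + t by rewrite addr_gt0.
  have d1 := is_derive_addf (is_derive_cst (1 : R) t 1)
    (is_derive_id t (1 : R)).
  have d2 := is_derive_subf (is_derive1_ln t0)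
    (is_derive_compf (is_derive1_ln t1) d1).
  have := is_derive_cmul (4 / a) (is_derive_compf (is_derive_expR _)
    (is_derive_cmul a d2)).
  by move/is_derive_eq; apply; rewrite /G'; field; rewrite !gt_eqF.
have cG' (t : R) : 0 < t -> {for t, continuous G'}.
  move=> t0; have t1 : 0 < 1 + t by rewrite addr_gt0.
  have d1 := is_derive_addf (is_derive_cst (1 : R) t 1)
    (is_derive_id t (1 : R)).
  have d2 := is_derive_subf (is_derive1_ln t0)
    (is_derive_compf (is_derive1_ln t1) d1).
  have d3 := is_derive_compf (is_derive_expR _) (is_derive_cmul a d2).
  have d4 := is_derive_mulf (is_derive_id t (1 : R)) d1.
  apply: continuousM; first exact: cvg_cst.
  apply: continuousM.
    by apply: differentiable_continuous; apply/derivable1_diffP; case: d3.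
  apply: continuousV; first by rewrite gt_eqF // mulr_gt0.
  by apply: differentiable_continuous; apply/derivable1_diffP; case: d4.
have G'le t : 0 < t -> gamma_kernel a t <= G' t.
  move=> t0; have t1 : 0 < 1 + t by rewrite addr_gt0.
  rewrite /gamma_kernel /G'.
  have e : expR (a * (ln t - ln (1 + t))) / (t * (1 + t))
     = expR ((a - 1) * ln t) * (expR (- (a + 1) * ln (1 + t))).
    have -> : t * (1 + t) = expR (ln t + ln (1 + t)) by rewrite expRD !lnK.
    by rewrite -expRB -expRD; congr expR; ring.
  rewrite e mulrCA expRD ler_pM2l ?expR_gt0 //.
  have l0 : 0 <= ln (1 + t) by rewrite ln_ge0 // lerDl ltW.
  apply: (@le_trans _ _ (4 * expR (- 2 * ln (1 + t)))); last first.
    rewrite ler_pM2l // ler_expR; nra.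
  have -> : expR (- 2 * ln (1 + t)) = ((1 + t) ^+ 2)^-1.
    by rewrite mulNr expRN expRM_natl lnK.
  rewrite expRN ler_pdivlMr ?exprn_gt0 // mulrC ler_pdivrMr ?expR_gt0 //.
  have := expR_ge1Dxn 1 (ltW t0); have := expR_ge1Dx t.
  by rewrite (_ : 2`!%:R = 2) //; nra.
have k0 : 0 < (k.+1%:R ^+ 1)^-1 :> R by rewrite invr_gt0 exprn_gt0.
apply: (@le_trans _ _ (\int[mu]_(t in @exhaust R 0 k) (G' t)%:E)%E).
  have mk : measurable (@exhaust R 0 k) by exact: measurable_itv.
  apply: ge0_le_integral => //.
  - by move=> t _; rewrite lee_fin gamma_kernel_ge0.
  - by apply/measurable_EFinP/measurable_funTS; exact: measurable_gamma_kernel.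
  - apply/measurable_EFinP; apply: subspace_continuous_measurable_fun => //.
    exact: (pos_continuous_within k0 cG').
  - by move=> t /exhaust_gt0 t0; rewrite lee_fin G'le.
rewrite /exhaust (pos_FTC k0 (exhaust_le R k) dG cG') lee_fin.
apply: (@le_trans _ _ (G (k.+1%:R ^+ 1))).
  by rewrite gerBl /G mulr_ge0 ?expR_ge0 // divr_ge0 // ltW.
rewrite /G -[leRHS]mulr1 ler_pM2l ?divr_gt0 // expR_le1 expr1.
rewrite mulr_ge0_le0 // ?(ltW a0) // subr_le0 ler_ln ?posrE ?addr_gt0 //.
by rewrite lerDr.
Qed.

Lemma pow_exp_cvg0 (a : R) : 0 < a ->
  expR (a * ln k.+1%:R - k.+1%:R) @[k --> \oo] --> (0 : R).
Proof.
(* From ln z <= z at z = t/(2a): half of t absorbs the power, and the other half leaves e^(-t/2) <=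
   2/t. *)
move=> a0; pose C := 2 * expR (a * ln (2 * a)).
have cC : C * harmonic k @[k --> \oo] --> (0 : R).
  by rewrite -[X in _ --> X](mulr0 C); apply: cvgM;
    [exact: cvg_cst|exact: cvg_harmonic].
apply: (squeeze_cvgr _ (cvg_cst 0) cC); apply: nearW => k; rewrite expR_ge0 /=.
set t := k.+1%:R : R; have t0 : 0 < t by rewrite /t ltr0n.
have a2 : 0 < 2 * a by rewrite mulr_gt0.
have e : ln t = ln (2 * a) + ln (t / (2 * a)).
  by rewrite -lnM ?posrE ?divr_gt0 // mulrCA divff ?mulr1 // gt_eqF.
have l : ln (t / (2 * a)) <= t / (2 * a) by apply/ltW/ln_sublinear;
  rewrite divr_gt0.
have l2 : a * ln t <= a * ln (2 * a) + t / 2.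
  rewrite e mulrDr lerD2l; apply: le_trans (ler_wpM2l (ltW a0) l) _.
  by rewrite le_eqVlt; apply/orP; left; apply/eqP; field; rewrite gt_eqF.
apply: (@le_trans _ _ (expR (a * ln (2 * a) - t / 2))); first
  by rewrite ler_expR; lra.
have -> : C * t^-1 = expR (a * ln (2 * a)) * (2 * t^-1) by rewrite /C; ring.
rewrite expRD ler_pM2l ?expR_gt0 // expRN.
have -> : 2 * t^-1 = (t / 2)^-1 by field; rewrite gt_eqF.
rewrite lef_pV2 ?posrE ?expR_gt0 ?divr_gt0 //.
by have := expR_ge1Dx (t / 2); lra.
Qed.

Lemma pow_exp_cvg0_inv (a : R) : 0 < a ->
  expR (a * ln k.+1%:R^-1 - k.+1%:R^-1) @[k --> \oo] --> (0 : R).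
Proof.
move=> a0.
have cp : (@harmonic R k) `^ a @[k --> \oo] --> (0 : R).
  have /cvg_at_rightP := powR_cvg0 a0; apply; split; last exact: cvg_harmonic.
  by move=> n; rewrite /harmonic /= invr_gt0.
apply: (squeeze_cvgr _ (cvg_cst 0) cp); apply: nearW => k; rewrite expR_ge0 /=.
by rewrite /harmonic /powR gt_eqF ?invr_gt0 // ler_expR gerBl invr_ge0.
Qed.

(** Integration by parts on the compact intervals; the boundary terms [d k] tend to 0 at both
    ends. *)
Lemma gamma_kernel_step a (I : R) : 0 < a ->
  (\int[mu]_(t in `]0%R, +oo[) (gamma_kernel a t)%:E = I%:E)%E ->
  (\int[mu]_(t in `]0%R, +oo[) (gamma_kernel (a + 1) t)%:E = (I * a)%:E)%E.
Proof.
move=> a0 HI.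
have c0 := @exhaust_cvg R 0 _ (measurable_gamma_kernel a)
  (fun x _ => gamma_kernel_ge0 a x).
have c1 := @exhaust_cvg R 0 _ (measurable_gamma_kernel (a + 1))
  (fun x _ => gamma_kernel_ge0 _ x).
pose F (t : R) := expR (a * ln t - t).
pose d k := F k.+1%:R - F k.+1%:R^-1.
have d0 : (d k)%:E @[k --> \oo] --> (0%:E : \bar R).
  apply: cvg_EFin; first exact: nearW.
  by rewrite -[X in _ --> X](subr0 0); apply: cvgB;
    [exact: pow_exp_cvg0|exact: pow_exp_cvg0_inv].
have e k : (\int[mu]_(t in @exhaust R 0 k) (gamma_kernel (a + 1) t)%:E
   = a%:E * \int[mu]_(t in @exhaust R 0 k) (gamma_kernel a t)%:E - (d k)%:E)%E.
  have k0 : 0 < (k.+1%:R ^+ 1)^-1 :> R by rewrite invr_gt0 exprn_gt0.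
  have ig b : mu.-integrable (@exhaust R 0 k) (EFin \o gamma_kernel b).
    apply: continuous_compact_integrable; first exact: segment_compact.
    exact: (pos_continuous_within k0 (@continuous_gamma_kernel b)).
  have cf x : 0 < x -> {for x, continuous (fun t => a * gamma_kernel a t
    - gamma_kernel (a + 1) t)}.
    move=> x0; apply: continuousB; last exact: continuous_gamma_kernel.
    by apply: continuousM; [exact: cvg_cst|exact: continuous_gamma_kernel].
  have := pos_FTC k0 (exhaust_le R k) (@is_derive_pow_exp a) cf.
  rewrite -/(exhaust 0 k) expr1 -/F -/(d k).
  have mk : measurable (@exhaust R 0 k) by exact: measurable_itv.
  have fin b : exists u, (\int[mu]_(t in @exhaust R 0 k)
    (gamma_kernel b t)%:E = u%:E)%E.
    exists (fine (\int[mu]_(t in @exhaust R 0 k) (gamma_kernel b t)%:E)).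
    by rewrite fineK //; apply: integrable_fin_num => //; exact: ig.
  have iga : mu.-integrable (@exhaust R 0 k)
    (EFin \o (fun t => a * gamma_kernel a t)).
    have -> : EFin \o (fun t => a * gamma_kernel a t)
        = (fun t => a%:E * (EFin \o gamma_kernel a) t)%E.
      by apply/funext => t; rewrite /= EFinM.
    by apply: integrableZl => //; exact: ig.
  have -> : (\int[mu]_(x in @exhaust R 0 k)
    (a * gamma_kernel a x - gamma_kernel (a + 1) x)%:E
    = a%:E * \int[mu]_(t in @exhaust R 0 k) (gamma_kernel a t)%:E
      - \int[mu]_(t in @exhaust R 0 k) (gamma_kernel (a + 1) t)%:E)%E.
    under eq_integral do rewrite EFinB.
    rewrite (integralB_EFin _ iga (ig (a + 1))) // -(integralZl _ (ig a)) //.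
  have [u ->] := fin a; have [v ->] := fin (a + 1).
  by rewrite -EFinM -!EFinB => -[<-]; congr EFin; ring.
have c2 : (a%:E * \int[mu]_(t in @exhaust R 0 k) (gamma_kernel a t)%:E
  - (d k)%:E
    @[k --> \oo] --> a%:E * I%:E - 0%:E)%E.
  by apply: cvgeB => //; apply: cvgeZl => //; rewrite -HI.
rewrite -(funext e) in c2.
by rewrite (cvg_unique _ c1 c2) // sube0 -EFinM mulrC.
Qed.

Lemma gamma_moment a m : 0 < a <= 1 ->
  (\int[mu]_(t in `]0%R, +oo[) (gamma_kernel (a + m%:R) t)%:E
   = (Gamma a * pochhammer a m)%:E)%E.
Proof.
move=> a01; have /andP[a0 a1] := a01.
elim: m => [|m IH].
  rewrite addr0 pochhammer0 mulr1 /Gamma /Rintegral.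
  have -> : (\int[mu]_(t in `]0%R, +oo[) (t `^ (a - 1) * expR (- t))%:E
    = \int[mu]_(t in `]0%R, +oo[) (gamma_kernel a t)%:E)%E.
    apply: eq_integral => t; rewrite inE /= in_itv /= andbT => t0.
    by rewrite /powR gt_eqF // -expRD.
  rewrite fineK // ge0_fin_numE ?gamma_kernel_finite //.
  by apply: integral_ge0 => t _; rewrite lee_fin gamma_kernel_ge0.
have := gamma_kernel_step (ltr_wpDr (ler0n _ m) a0) IH.
by rewrite -addrA natr1 => ->; rewrite pochhammerS mulrA.
Qed.
End gamma_moments.

(** * The two sequences as integrals against one weight *)

Section error_integrals.
Variables (R : realType) (n : nat).
Notation mu := (@lebesgue_measure R).
Let nu : R := 1 / 6.
Let half01 : 0 < (1 / 2 : R) <= 1. Proof. by lra. Qed.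
Let third01 : 0 < (1 / 3 : R) <= 1. Proof. by lra. Qed.

(** The exponents 3n - nu + (2k - n + nu) and 3n - nu + (2k - n - nu) equal 2 (a + n + k) - 1 for a
    = 1/2 and a = 1/3 respectively; this is where 1/2 - 1/3 = nu is used. *)
Definition weight (s : R) := 2 * expR ((3 * n%:R - nu) * ln s - s ^+ 2).
Definition denom_integrand s := weight s * scaled_jacobi nu n (ln s).
Definition numer_integrand s := weight s * scaled_jacobi nu n (- ln s).

Lemma sqr_gamma_kernel (c s : R) : 0 < s ->
  gamma_kernel c (s ^+ 2) * (2 * s) = 2 * expR ((2 * c - 1) * ln s - s ^+ 2).
Proof.
move=> s0; rewrite /gamma_kernel lnXn //.
have e : s = expR (ln s) by rewrite lnK.
rewrite [X in _ * (2 * X)]e mulrCA -expRD; congr (_ * expR _); ring.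
Qed.

Lemma integral_sqr_gamma_kernel a m : 0 < a <= 1 ->
  (\int[mu]_(s in `]0%R, +oo[) (gamma_kernel (a + m%:R) (s ^+ 2) * (2 * s))%:E
   = (Gamma a * pochhammer a m)%:E)%E.
Proof.
move=> a01; rewrite -gamma_moment // integral_sqr_substitution //.
- exact: measurable_gamma_kernel.
- by move=> x _; exact: gamma_kernel_ge0.
- exact: continuous_gamma_kernel.
Qed.

Lemma integral_moment_sum (a : R) (c : nat -> R) (f : R -> R) : 0 < a <= 1 ->
  (forall k, (k <= n)%N -> 0 <= c k) ->
  (forall s, 0 < s -> f s = \sum_(k < n.+1) c k
     * (gamma_kernel (a + (n + k)%:R) (s ^+ 2) * (2 * s))) ->
  (\int[mu]_(s in `]0%R, +oo[) (f s)%:E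
   = (Gamma a * \sum_(k < n.+1) c k * pochhammer a (n + k))%:E)%E.
Proof.
move=> a01 c0 fE.
have mg k : measurable_fun setT (fun s : R => gamma_kernel (a + (n + k)%:R)
  (s ^+ 2) * (2 * s)).
  apply: measurable_funM; last exact: mulrl_measurable.
  apply: measurableT_comp; first exact: measurable_gamma_kernel.
  exact: exprn_measurable.
transitivity (\int[mu]_(s in `]0%R, +oo[) (\sum_(k < n.+1) (c k
   * (gamma_kernel (a + (n + k)%:R) (s ^+ 2) * (2 * s)))%:E))%E.
  by apply: eq_integral => s; rewrite inE /= in_itv /= andbT => /fE ->;
    rewrite sumEFin.
rewrite ge0_integral_sum //=.
- rewrite mulr_sumr -sumEFin; apply: eq_bigr => k _.
  have kn : (k <= n)%N by rewrite -ltnS.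
  under eq_integral do rewrite EFinM.
  rewrite ge0_integralZl_EFin ?c0 //.
  + by rewrite integral_sqr_gamma_kernel // -EFinM mulrCA.
  + move=> s; rewrite /= in_itv /= andbT => s0.
    by rewrite lee_fin mulr_ge0 ?gamma_kernel_ge0 // mulr_ge0 // ltW.
  + by apply/measurable_EFinP/measurable_funTS; exact: mg.
- move=> k; apply/measurable_EFinP/measurable_funTS.
  by apply: measurable_funM => //; exact: mg.
- move=> k s; rewrite /= in_itv /= andbT => s0.
  have kn : (k <= n)%N by rewrite -ltnS.
  by rewrite lee_fin mulr_ge0 ?c0 // mulr_ge0 ?gamma_kernel_ge0 // mulr_ge0 //
    ltW.
Qed.

Lemma gbinom_sixth_ge0 (e : R) k : -1 <= e -> (k <= n)%N -> 0
  <= gbinom (n%:R + e) k.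
Proof.
move=> e1 kn; apply: gbinom_ge0.
have : (k%:R : R) <= n%:R by rewrite ler_nat.
by lra.
Qed.

Lemma integral_denom :
  (\int[mu]_(s in `]0%R, +oo[) (denom_integrand s)%:E
    = (Gamma (1 / 2) * q_seq R n)%:E)%E.
Proof.
rewrite (@integral_moment_sum (1 / 2) (fun k => gbinom (n%:R - nu) k
   * gbinom (n%:R + nu) (n - k))) //.
  by move=> k kn; rewrite mulr_ge0 // gbinom_sixth_ge0 // ?leq_subr // /nu; lra.
move=> s s0; rewrite /denom_integrand /scaled_jacobi mulr_sumr;
  apply: eq_bigr => k _.
rewrite sqr_gamma_kernel // mulrCA; congr (_ * _).
by rewrite /weight -mulrA -expRD; congr (_ * expR _); rewrite natrD; field.
Qed.

Lemma integral_numer :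
  (\int[mu]_(s in `]0%R, +oo[) (numer_integrand s)%:E
    = (Gamma (1 / 3) * p_seq R n)%:E)%E.
Proof.
rewrite (@integral_moment_sum (1 / 3) (fun k => gbinom (n%:R + nu) k
   * gbinom (n%:R - nu) (n - k))) //.
  by move=> k kn; rewrite mulr_ge0 // gbinom_sixth_ge0 // ?leq_subr // /nu; lra.
move=> s s0; rewrite /numer_integrand scaled_jacobiN /scaled_jacobi mulr_sumr;
  apply: eq_bigr => k _.
rewrite sqr_gamma_kernel // opprK mulrCA; congr (_ * _).
by rewrite /weight -mulrA -expRD; congr (_ * expR _); rewrite natrD /nu; field.
Qed.

Lemma Gamma_half : Gamma (1 / 2 : R) = Num.sqrt pi.
Proof.
have := integral_sqr_gamma_kernel 0 half01; rewrite pochhammer0 mulr1 => e.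
suff : (\int[mu]_(s in `]0%R, +oo[)
  (gamma_kernel (1 / 2 + 0) (s ^+ 2) * (2 * s))%:E
   = (Num.sqrt pi)%:E)%E by rewrite e => -[].
transitivity (\int[mu]_(s in `]0%R, +oo[) (2%:E * (gauss_fun s)%:E))%E.
  apply: eq_integral => s; rewrite inE /= in_itv /= andbT => s0.
  by rewrite sqr_gamma_kernel // -EFinM /gauss_fun; congr (_ * expR _)%:E;
    field.
rewrite ge0_integralZl_EFin //.
- rewrite integral_itv_obnd_cbnd; last first.
    by apply/measurable_EFinP/measurable_funTS; exact: measurable_gauss_fun.
  by rewrite integral0y_gauss -EFinM; congr EFin; field.
- by move=> s _; rewrite lee_fin gauss_fun_ge0.
- by apply/measurable_EFinP/measurable_funTS; exact: measurable_gauss_fun.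
Qed.
End error_integrals.

(** * Laplace's method *)

Section laplace_pointwise.
Variable R : realType.

(** In terms of u = ln (1 + z) the remainder has derivative (e^u - 1)^2, while (e^u - 1)^3 / 3 has
    an additional factor e^u. That factor is at least 1 for u >= 0 and at least 1/2 for u between y
    and 0, hence the doubling for negative z. *)
Lemma ln_taylor2 (z : R) : `|z| <= 1 / 2 -> `|ln (1 + z) - z + z ^+ 2 / 2|
  <= `|z| ^+ 3.
Proof.
rewrite ler_norml => /andP[z1 z2].
have z0 : 0 < 1 + z by lra.
set y := ln (1 + z).
have ez : z = expR y - 1 by rewrite lnK //; ring.
pose f (u : R) := u - (expR u - 1) + (expR u - 1) ^+ 2 / 2.
pose h (u : R) := (expR u - 1) ^+ 3 / 3.
have de (u : R) : is_derive u 1 (fun u => expR u - 1) (expR u).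
  have := is_derive_subf (is_derive_expR u) (is_derive_cst (1 : R) u 1).
  by move/is_derive_eq; apply; rewrite subr0.
have df (u : R) : is_derive u 1 f ((expR u - 1) ^+ 2).
  have := is_derive_addf (is_derive_subf (is_derive_id u (1 : R)) (de u))
    (is_derive_mulf (is_derive_expn 1 (de u)) (is_derive_cst (2^-1 : R) u 1)).
  by move/is_derive_eq; apply; rewrite /cst /=; field.
have dh (u : R) : is_derive u 1 h ((expR u - 1) ^+ 2 * expR u).
  have := is_derive_mulf (is_derive_expn 2 (de u))
    (is_derive_cst (3^-1 : R) u 1).
  by move/is_derive_eq; apply; rewrite /cst /=; field.
have f0 : f 0 = 0 by rewrite /f expR0; ring.
have h0 : h 0 = 0 by rewrite /h expR0; ring.
have fy : f y = ln (1 + z) - z + z ^+ 2 / 2 by rewrite /f -ez.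
have hy : h y = z ^+ 3 / 3 by rewrite /h -ez.
rewrite -fy; have [y0|/ltW y0] := leP 0 y.
  have z0' : 0 <= z by rewrite ez subr_ge0 -expR0 ler_expR.
  have H1 := derive_increment_le y0 (fun u => is_derive_cst (0 : R) u 1) df.
  have H2 := derive_increment_le y0 df dh.
  rewrite /cst f0 h0 !subr0 in H1 H2.
  have {}H1 : 0 <= f y by apply: H1 => u _; rewrite sqr_ge0.
  have {}H2 : f y <= h y.
    apply: H2 => u /andP[u0 _]; rewrite ler_peMr ?sqr_ge0 //.
    by rewrite -expR0 ler_expR.
  rewrite ger0_norm // ger0_norm // (le_trans H2) // hy.
  by have := exprn_ge0 3 z0'; lra.
have z0' : z <= 0 by rewrite ez subr_le0 expR_le1.
have H1 := derive_increment_le y0 (fun u => is_derive_cst (0 : R) u 1) df.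
have H2 := derive_increment_le y0 df (fun u => is_derive_cmul 2 (dh u)).
rewrite f0 in H1; rewrite f0 h0 mulr0 !sub0r in H2.
have {}H1 : 0 <= - f y by have := H1 (fun u _ => sqr_ge0 _); rewrite /cst; lra.
have {}H2 : - f y <= - (2 * h y).
  apply: H2 => u /andP[uy _]; rewrite mulrCA ler_peMr ?sqr_ge0 //.
  have : expR y <= expR u by rewrite ler_expR.
  by rewrite lnK //; lra.
rewrite -normrN ger0_norm // ler0_norm // (le_trans H2) // hy.
by have := exprn_ge0 3 (ltac:(lra) : 0 <= - z); rewrite exprNn; lra.
Qed.

Lemma ln_lipschitz (z : R) : `|z| <= 1 / 2 -> `|ln (1 + z)| <= 2 * `|z|.
Proof.
move=> zh; have := zh; rewrite ler_norml => /andP[z1 z2].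
have z0 : 0 < 1 + z by lra.
have u : ln (1 + z) <= z by have := expR_ge1Dx (ln (1 + z)); rewrite lnK //;
  lra.
have l : - ln (1 + z) <= (1 + z)^-1 - 1.
  have := expR_ge1Dx (- ln (1 + z)); rewrite expRN lnK //; lra.
have e : (1 + z)^-1 - 1 = - z * (1 + z)^-1 by field; rewrite gt_eqF.
have i0 : 0 < (1 + z)^-1 by rewrite invr_gt0.
have i2 : (1 + z)^-1 <= 2 by rewrite invf_ple ?posrE //; lra.
rewrite ler_norml; rewrite e in l.
by have [p|m] := leP 0 z; rewrite ?(ger0_norm p) ?(ltr0_norm m);
  apply/andP; split; nra.
Qed.

Variables (n : nat) (V eps : R).
Hypothesis V_large : 20 <= V.
Hypothesis V_sqr : V ^+ 2 = 2 * n%:R.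
Hypothesis eps_sign : eps = 1 \/ eps = -1.

(* [V - eps / 2] is the saddle point of [main_term] up to lower order terms and
   [shifted s] the distance of [s] to it. *)
Definition main_term (s : R) :=
  expR ((2 * n%:R - 2 / 3) * ln s - s ^+ 2) * (s + eps) ^+ (2 * n).+1.
(** What is independent of [shifted s] after both logarithms are expanded at V to second order. Its
    values for eps = 1 and eps = -1 have quotient e^(2V), the source of the exponential in the
    theorem. *)
Definition main_norm :=
  expR ((4 * n%:R + 1 / 3) * ln V - V ^+ 2 + eps * V - 1 / 2).
Definition shifted (s : R) := s - V + eps / 2.
Definition gauss_main (s : R) := expR (- 2 * shifted s ^+ 2 + eps * shifted s).
Definition gauss_tail (s : R) := expR (- (shifted s ^+ 2 / 4)).

Let V0 : 0 < V. Proof. by move: V_large; lra. Qed.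
Let eps2 : eps ^+ 2 = 1. Proof. by case: eps_sign => ->; ring. Qed.
Let eps_le1 : -1 <= eps <= 1. Proof. by case: eps_sign => ->; lra. Qed.

Lemma main_term_log s : 1 < s -> main_term s / main_norm
  = expR ((V ^+ 2 - 2 / 3) * ln (1 + (shifted s - eps / 2) / V)
    + (V ^+ 2 + 1) * ln (1 + (shifted s + eps / 2) / V)
    - s ^+ 2 + V ^+ 2 - eps * V + 1 / 2).
Proof.
move=> s1; have s0 : 0 < s by lra.
have se : 0 < s + eps by have := eps_le1; lra.
have -> : 1 + (shifted s - eps / 2) / V = s / V by rewrite /shifted; field;
  rewrite gt_eqF.
have -> : 1 + (shifted s + eps / 2) / V = (s + eps) / V.
  by rewrite /shifted; field; rewrite gt_eqF.
rewrite !ln_div ?posrE // /main_term /main_norm.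
have -> : (s + eps) ^+ (2 * n).+1 = expR ((2 * n).+1%:R * ln (s + eps)).
  by rewrite expRM_natl lnK.
by rewrite -expRD -expRB; congr expR; rewrite V_sqr -(natr1 (2 * n)) natrM;
  field.
Qed.

(** A bound valid far from the saddle: ln (1 + z) <= z cancels the linear terms against those of s^2
    and loses only half of the quadratic decay. *)
Lemma main_term_le s : 1 < s ->
  main_term s / main_norm <= expR (- shifted s ^+ 2 + 2 * `|shifted s| + 3).
Proof.
move=> s1; rewrite main_term_log // ler_expR.
set w := shifted s; have vl := V_large; have v0 := V0; have s0 : 0 < s by lra.
have e1 := eps_le1; have se : 0 < s + eps by lra.
have sE : s = V + w - eps / 2 by rewrite /w /shifted; ring.
set a := (w - eps / 2) / V; set b := (w + eps / 2) / V.
have aV : a * V = w - eps / 2 by rewrite /a divfK // gt_eqF.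
have bV : b * V = w + eps / 2 by rewrite /b divfK // gt_eqF.
have a0 : 0 < 1 + a.
  have -> : 1 + a = s / V by rewrite /a sE; field; rewrite gt_eqF.
  exact: divr_gt0.
have b0 : 0 < 1 + b.
  have -> : 1 + b = (s + eps) / V by rewrite /b sE; field; rewrite gt_eqF.
  exact: divr_gt0.
have lnle (x : R) : 0 < 1 + x -> ln (1 + x) <= x.
  by move=> x0; have := expR_ge1Dx (ln (1 + x)); rewrite lnK //; lra.
have la := lnle _ a0; have lb := lnle _ b0.
(* The surplus -2/3 ln (1 + a) is unbounded above when a is near -1; it has to be offset by ln (1 +
   b). *)
have lba : ln (1 + b) <= ln (1 + a) + 1.
  have -> : 1 + b = (1 + a) * ((1 + b) / (1 + a)) by rewrite mulrC divfK //
    gt_eqF.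
  rewrite lnM ?posrE ?divr_gt0 // lerD2l.
  have -> : (1 + b) / (1 + a) = 1 + (eps / s).
    have -> : 1 + a = s / V by rewrite /a sE; field; rewrite gt_eqF.
    have -> : 1 + b = (s + eps) / V by rewrite /b sE; field; rewrite gt_eqF.
    by field; rewrite !gt_eqF.
  have q : eps / s <= 1 by rewrite ler_pdivrMr //; lra.
  have q0 : 0 < 1 + eps / s.
    have -> : 1 + eps / s = (s + eps) / s by field; rewrite gt_eqF.
    exact: divr_gt0.
  by have := lnle _ q0; lra.
have e2 := eps2.
have wn0 : 0 <= `|w| by [].
have aw : a <= `|w| + 1.
  have : a * V <= (`|w| + 1) * V.
    have wle := ler_norm w; rewrite aV.
    have := mulr_ge0 (addr_ge0 wn0 ler01) (ltac:(lra) : 0 <= V - 1); lra.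
  by rewrite ler_pM2r.
have V2 : 0 <= V ^+ 2 - 2 / 3 by nra.
apply: (@le_trans _ _ (V ^+ 2 * a + V ^+ 2 * b + (`|w| + 2)
   - s ^+ 2 + V ^+ 2 - eps * V + 1 / 2)).
  have h1 : V ^+ 2 * ln (1 + a) <= V ^+ 2 * a by rewrite ler_wpM2l ?sqr_ge0.
  have h2 : V ^+ 2 * ln (1 + b) <= V ^+ 2 * b by rewrite ler_wpM2l ?sqr_ge0.
  by lra.
have -> : V ^+ 2 * a = V * (w - eps / 2) by rewrite -aV; ring.
have -> : V ^+ 2 * b = V * (w + eps / 2) by rewrite -bV; ring.
have ew : eps * w <= `|w|.
  by rewrite (le_trans (ler_norm _)) // normrM; case: eps_sign => ->;
    rewrite ?normrN normr1 mul1r.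
rewrite sE; lra.
Qed.

Definition envelope (s : R) := expR (- shifted s ^+ 2 + 2 * `|shifted s| + 3).
(** The product of the 6 in [main_term_log_close] and the 6 e^7 in [envelope_cube_le]. *)
Definition laplace_const : R := 36 * expR 7.

Lemma eps_shifted_le s : `|eps * shifted s| <= `|shifted s|.
Proof. by rewrite normrM; case: eps_sign => ->;
  rewrite ?normrN normr1 mul1r. Qed.

Lemma gauss_main_le s : gauss_main s <= envelope s.
Proof.
rewrite ler_expR; have := eps_shifted_le s; rewrite ler_norml => /andP[_ h].
by have := sqr_ge0 (shifted s); have := normr_ge0 (shifted s); lra.
Qed.

Lemma envelope_cube_le s :
  (`|shifted s| + 1) ^+ 3 * envelope s <= 6 * expR 7 * gauss_tail s.
Proof.
rewrite /envelope /gauss_tail; set w := shifted s; set p := `|w|.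
have p0 : 0 <= p by exact: normr_ge0.
have wp : w ^+ 2 = p ^+ 2 by rewrite real_normK ?num_real.
have c := expR_ge1Dxn 2 (addr_ge0 p0 ler01).
have {}c : (p + 1) ^+ 3 <= 6 * expR (p + 1).
  by move: c; rewrite (_ : 3`!%:R = 6) //; lra.
apply: (le_trans (ler_wpM2r (expR_ge0 _) c)).
rewrite -!mulrA ler_pM2l // -!expRD ler_expR wp.
(* The exponent 3p + 4 - 3p^2/4 equals 7 - 3 (p - 2)^2 / 4, whence the 7. *)
have := sqr_ge0 (p - 2); nra.
Qed.

Lemma expR_sub_le (x y m : R) : expR x <= m -> expR y <= m ->
  `|expR x - expR y| <= `|x - y| * m.
Proof.
wlog yx : x y / y <= x => [H xm ym|].
  have [|/ltW xy] := leP y x => [yx|]; first exact: H.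
  by rewrite distrC [X in _ <= X * _]distrC; exact: H.
move=> xm ym; rewrite !ger0_norm ?subr_ge0 ?ler_expR //.
have -> : expR x - expR y = expR x * (1 - expR (y - x)).
  by rewrite mulrBr mulr1 -expRD; congr (_ - expR _); ring.
have e := expR_ge1Dx (y - x).
apply: (@le_trans _ _ (expR x * (x - y))).
  by rewrite ler_pM2l ?expR_gt0 //; lra.
by rewrite mulrC ler_wpM2l // subr_ge0.
Qed.

(** With p = |w| + 1, w being [shifted s], each cubic Taylor remainder costs V^2 (p/V)^3 = p^3/V,
    and the first-order surplus -2/3 ln + ln at most 4 p/V. The range |w| <= V/4 keeps p/V below
    1/2. *)
Lemma main_term_log_close s : 1 < s -> `|shifted s| <= V / 4 ->
  `|(V ^+ 2 - 2 / 3) * ln (1 + (shifted s - eps / 2) / V)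
    + (V ^+ 2 + 1) * ln (1 + (shifted s + eps / 2) / V)
    - s ^+ 2 + V ^+ 2 - eps * V + 1 / 2
      - (- 2 * shifted s ^+ 2 + eps * shifted s)|
  <= 6 * (`|shifted s| + 1) ^+ 3 / V.
Proof.
move=> s1; set w := shifted s => wV; have vl := V_large; have v0 := V0.
have e1 := eps_le1; have e2 := eps2.
have sE : s = V + w - eps / 2 by rewrite /w /shifted; ring.
set a := (w - eps / 2) / V; set b := (w + eps / 2) / V.
have aV : a * V = w - eps / 2 by rewrite /a divfK // gt_eqF.
have bV : b * V = w + eps / 2 by rewrite /b divfK // gt_eqF.
set p := `|w| + 1; have p1 : 1 <= p by rewrite lerDr normr_ge0.
have ne : `|eps / 2| <= 1 / 2 by rewrite ler_norml; apply/andP; split; lra.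
have na : `|a| <= p / V.
  rewrite /a normrM [X in _ * X]gtr0_norm ?invr_gt0 // ler_pM2r ?invr_gt0 //.
  by rewrite (le_trans (ler_normB _ _)) // /p; lra.
have nb : `|b| <= p / V.
  rewrite /b normrM [X in _ * X]gtr0_norm ?invr_gt0 // ler_pM2r ?invr_gt0 //.
  by rewrite (le_trans (ler_normD _ _)) // /p; lra.
have pV : p / V <= 1 / 2 by rewrite ler_pdivrMr // /p; lra.
have ta := ln_taylor2 (le_trans na pV).
have tb := ln_taylor2 (le_trans nb pV).
have la := ln_lipschitz (le_trans na pV).
have lb := ln_lipschitz (le_trans nb pV).
have -> : (V ^+ 2 - 2 / 3) * ln (1 + a) + (V ^+ 2 + 1) * ln (1 + b)
    - s ^+ 2 + V ^+ 2 - eps * V + 1 / 2 - (- 2 * w ^+ 2 + eps * w)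
  = V ^+ 2 * (ln (1 + a) - a + a ^+ 2 / 2) + V ^+ 2
    * (ln (1 + b) - b + b ^+ 2 / 2)
    + (- 2 / 3 * ln (1 + a) + ln (1 + b)).
  have E1 : V ^+ 2 * (- a + a ^+ 2 / 2) = - V * (a * V) + (a * V) ^+ 2 / 2
    by field.
  have E2 : V ^+ 2 * (- b + b ^+ 2 / 2) = - V * (b * V) + (b * V) ^+ 2 / 2
    by field.
  rewrite aV in E1; rewrite bV in E2; rewrite sE; lra.
have cube (z : R) : `|z| <= p / V -> `|z| ^+ 3 <= (p / V) ^+ 3.
  by move=> zp; rewrite lerXn2r ?nnegrE // (le_trans _ zp).
have ca := cube _ na; have cb := cube _ nb.
have Vc : V ^+ 2 * (p / V) ^+ 3 = p ^+ 3 / V by field; rewrite gt_eqF.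
have tA : `|V ^+ 2 * (ln (1 + a) - a + a ^+ 2 / 2)| <= p ^+ 3 / V.
  rewrite normrM ger0_norm ?sqr_ge0 // -Vc ler_wpM2l ?sqr_ge0 //.
  exact: le_trans ta ca.
have tB : `|V ^+ 2 * (ln (1 + b) - b + b ^+ 2 / 2)| <= p ^+ 3 / V.
  rewrite normrM ger0_norm ?sqr_ge0 // -Vc ler_wpM2l ?sqr_ge0 //.
  exact: le_trans tb cb.
have p3 : p / V <= p ^+ 3 / V by rewrite ler_pM2r ?invr_gt0 //; nra.
have tC : `|- 2 / 3 * ln (1 + a) + ln (1 + b)| <= 4 * (p ^+ 3 / V).
  move: la lb; rewrite !ler_norml => /andP[l1 l2] /andP[l3 l4].
  apply/andP; split; lra.
have -> : 6 * p ^+ 3 / V = p ^+ 3 / V + p ^+ 3 / V + 4 * (p ^+ 3 / V) by field;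
  rewrite gt_eqF.
apply: (le_trans (ler_normD _ _)); apply: lerD => //.
by apply: (le_trans (ler_normD _ _)); exact: lerD.
Qed.

(** Outside the Taylor range the error factor already exceeds 1, so that there the envelope alone is
    a sufficient bound. *)
Lemma far_le s (x : R) : V / 4 <= `|shifted s| -> 0 <= x ->
  x <= 6 * (`|shifted s| + 1) ^+ 3 / V * x.
Proof.
move=> wV x0; have v0 := V0; rewrite ler_peMl // ler_pdivlMr // mul1r.
by have := normr_ge0 (shifted s); nra.
Qed.

Lemma envelope_const_le s : 6 * (`|shifted s| + 1) ^+ 3 / V * envelope s
  <= laplace_const / V * gauss_tail s.
Proof.
have v0 := V0; rewrite ![_ / V * _]mulrAC ler_pM2r ?invr_gt0 //.
rewrite /laplace_const -!mulrA.
by have := envelope_cube_le s; lra.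
Qed.

Lemma main_term_close s : 1 < s ->
  `|main_term s / main_norm - gauss_main s| <= laplace_const / V * gauss_tail s.
Proof.
move=> s1; apply: le_trans (envelope_const_le s).
have e0 : 0 <= envelope s by exact: expR_ge0.
have m1 := main_term_le s1; have m2 := gauss_main_le s.
have [wV|/ltW wV] := leP `|shifted s| (V / 4).
  have := main_term_log_close s1 wV; rewrite main_term_log // in m1 *.
  move=> h; apply: le_trans (expR_sub_le m1 m2) _.
  by rewrite ler_wpM2r.
apply: le_trans (far_le wV e0).
have m3 : 0 <= main_term s / main_norm by rewrite main_term_log // expR_ge0.
have m4 : 0 <= gauss_main s by exact: expR_ge0.
move: m1; rewrite -/(envelope s) => m1.
by rewrite ler_norml; apply/andP; split; lra.
Qed.

Lemma gauss_main_small s : s <= 1 -> gauss_main s <= laplace_const / V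
  * gauss_tail s.
Proof.
move=> s1; apply: le_trans (envelope_const_le s).
apply: le_trans (gauss_main_le s) _; apply: far_le; last exact: expR_ge0.
have vl := V_large; have e1 := eps_le1.
by rewrite ler0_norm /shifted; lra.
Qed.

(** The relative error s/n of the integrand is harmless because s <= V + p with p = |shifted s| + 1,
    and n = V^2/2. *)
Lemma main_term_moment s : 1 < s ->
  main_term s / main_norm * (s / n%:R) <= laplace_const / V * gauss_tail s.
Proof.
move=> s1; have vl := V_large; have v0 := V0; have e1 := eps_le1.
have n0 : 0 < n%:R :> R by have := V_sqr; nra.
apply: le_trans (envelope_const_le s).
rewrite [leRHS]mulrC; apply: ler_pM.
- by rewrite main_term_log // expR_ge0.
- by rewrite divr_ge0 //; lra.
- exact: main_term_le.
set p := `|shifted s| + 1; have p1 : 1 <= p by rewrite lerDr normr_ge0.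
have sp : s <= V + p.
  by have := ler_norm (shifted s); rewrite {1}/shifted /p; lra.
have nV : n%:R = V ^+ 2 / 2 by rewrite V_sqr; field.
rewrite ler_pdivrMr // nV.
have -> : 6 * p ^+ 3 / V * (V ^+ 2 / 2) = 3 * p ^+ 3 * V by field;
  rewrite gt_eqF.
have p3 : p <= p ^+ 3 by nra.
nra.
Qed.
End laplace_pointwise.

(** * Comparison of the integrands with their main terms *)

Section integrand_bounds.
Variables (R : realType) (n : nat).
Hypothesis n_gt0 : (0 < n)%N.
Let nu : R := 1 / 6.
Let g : R := jacobi_const nu n.
Let beta := wallis R n.

(** The 2 of [weight] times the 2 c beta_n of the pointwise asymptotics; common to both
    integrands. *)
Definition scale : R := 4 * g * beta.
Definition error_integrand (s : R) := denom_integrand n s - numer_integrand n s.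

Lemma scale_gt0 : 0 < scale.
Proof.
have g0 : 0 < g := jacobi_const_gt0 R n; have b0 : 0 < beta := wallis_gt0 R n.
by rewrite mulr_gt0 // mulr_gt0.
Qed.

Lemma ch_ln (s : R) : 0 < s -> ch (ln s) = expR (- (ln s / 2)) * (s + 1).
Proof.
move=> s0; rewrite /ch mulrDr mulr1; congr (_ + _).
have -> : expR (- (ln s / 2)) * s = expR (- (ln s / 2)) * expR (ln s)
  by rewrite lnK.
by rewrite -expRD; congr expR; field.
Qed.

Lemma sh_ln (s : R) : 0 < s -> sh (ln s) = expR (- (ln s / 2)) * (s - 1).
Proof.
move=> s0; rewrite /sh mulrBr mulr1; congr (_ - _).
have -> : expR (- (ln s / 2)) * s = expR (- (ln s / 2)) * expR (ln s)
  by rewrite lnK.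
by rewrite -expRD; congr expR; field.
Qed.

Lemma weight_main (s c d : R) : 0 < s -> c = expR (- (ln s / 2)) * d ->
  weight n s * (2 * g * (beta * c ^+ (2 * n).+1))
  = scale * (expR ((2 * n%:R - 2 / 3) * ln s - s ^+ 2) * d ^+ (2 * n).+1).
Proof.
move=> s0 ->; rewrite exprMn -expRM_natl /weight /scale -/nu.
have -> : expR ((2 * n%:R - 2 / 3) * ln s - s ^+ 2)
   = expR ((3 * n%:R - nu) * ln s - s ^+ 2)
     * expR ((2 * n).+1%:R * - (ln s / 2)).
  by rewrite -expRD; congr expR; rewrite -(natr1 (2 * n)) natrM /nu; field.
by ring.
Qed.

Lemma main_term_ge0 (eps s : R) : 1 < s -> -1 <= eps -> 0 <= main_term n eps s.
Proof. by move=> s1 e1; rewrite mulr_ge0 ?expR_ge0 // exprn_ge0 //; lra. Qed.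

Lemma weight_gt0 (s : R) : 0 < weight n s :> R.
Proof. by rewrite mulr_gt0 // expR_gt0. Qed.

Lemma ch_ln_sqr_le (s : R) : 1 < s -> ch (ln s) ^+ 2 <= 4 * s.
Proof.
move=> s1; have s0 : 0 < s by lra.
rewrite ch_sqr expRN lnK //.
have i1 : s^-1 <= 1 by rewrite invf_le1 // ltW.
by lra.
Qed.

Lemma sh_ln_sqr_le (s : R) : 1 < s -> sh (ln s) ^+ 2 <= s.
Proof.
move=> s1; have s0 : 0 < s by lra.
rewrite sh_sqr expRN lnK //.
have i1 : s^-1 <= 1 by rewrite invf_le1 // ltW.
by lra.
Qed.

Lemma denom_integrand_close (s : R) : 1 < s ->
  `|denom_integrand n s / scale - main_term n 1 s| <= main_term n 1 s
    * (12 * (s / n%:R)).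
Proof.
move=> s1; have s0 : 0 < s by lra.
have l0 : 0 <= ln s by rewrite ln_ge0 // ltW.
have k0 := scale_gt0; have w0 := weight_gt0 s.
have n0 : 0 < n%:R :> R by rewrite ltr0n.
have e := weight_main s0 (ch_ln s0); rewrite -/(main_term n 1 s) in e.
have H := scaled_jacobi_approx n_gt0 l0; rewrite -/nu -/g -/beta in H.
have -> : denom_integrand n s / scale - main_term n 1 s
   = (denom_integrand n s - scale * main_term n 1 s) / scale by field;
     rewrite gt_eqF.
rewrite normrM [X in _ * X]gtr0_norm ?invr_gt0 // ler_pdivrMr //
  [leRHS]mulrC [leRHS]mulrA -e.
have -> : denom_integrand n s - weight n s
  * (2 * g * (beta * ch (ln s) ^+ (2 * n).+1))
   = weight n s * (scaled_jacobi nu n (ln s) - 2 * g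
     * (beta * ch (ln s) ^+ (2 * n).+1)).
  by rewrite /denom_integrand -/nu; ring.
rewrite normrM gtr0_norm // -[leRHS]mulrA ler_pM2l //.
apply: (le_trans H); rewrite ler_wpM2l //.
  have g0 : 0 < g := jacobi_const_gt0 R n; have b0 : 0 < beta := wallis_gt0 R n.
  have c0 : 0 < ch (ln s) by rewrite (lt_le_trans _ (ch_ge2 _)).
  exact: ltW (mulr_gt0 (mulr_gt0 (ltr0Sn _ 1) g0)
    (mulr_gt0 b0 (exprn_gt0 _ c0))).
rewrite mulrA ler_pM2r ?invr_gt0 //; have := ch_ln_sqr_le s1; lra.
Qed.

Lemma error_integrandE (s : R) : error_integrand s = weight n s
  * (g * odd_primitive n (ln s) (ln s)).
Proof. by rewrite -scaled_jacobi_odd /error_integrand /denom_integrand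
  /numer_integrand -/nu; ring. Qed.

(** The relative error from [odd_primitive_ge] is weakened to the shape of [denom_integrand_close],
    so that one Laplace estimate covers both signs. *)
Lemma error_integrand_close (s : R) : 1 < s ->
  `|error_integrand s / scale - main_term n (-1) s| <= main_term n (-1) s
    * (12 * (s / n%:R)).
Proof.
move=> s1; have s0 : 0 < s by lra.
have l0 : 0 <= ln s by rewrite ln_ge0 // ltW.
have k0 := scale_gt0; have w0 := weight_gt0 s.
have n0 : 0 < n%:R :> R by rewrite ltr0n.
have g0 : 0 < g := jacobi_const_gt0 R n.
have e := weight_main s0 (sh_ln s0); rewrite -/(main_term n (-1) s) in e.
have m0 := main_term_ge0 s1 (lexx (-1)).
have H1 := odd_primitive_le n l0; have H2 := odd_primitive_ge n l0;
  rewrite -/beta in H1 H2.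
have q : sh (ln s) ^+ 2 / (8 * (2 * n%:R + 3)) <= 12 * (s / n%:R).
  have -> : 12 * (s / n%:R) = (12 * s) / n%:R by rewrite mulrA.
  have sq := sh_ln_sqr_le s1.
  apply: ler_pM; rewrite ?sqr_ge0 ?invr_ge0 ?lef_pV2 ?posrE //; lra.
have -> : error_integrand s / scale - main_term n (-1) s
   = (error_integrand s - scale * main_term n (-1) s) / scale by field;
     rewrite gt_eqF.
rewrite normrM [X in _ * X]gtr0_norm ?invr_gt0 // ler_pdivrMr //
  [leRHS]mulrC [leRHS]mulrA -e.
rewrite error_integrandE.
set B := beta * sh (ln s) ^+ (2 * n).+1 in H1 H2 e *.
have B0 : 0 <= B.
  by rewrite mulr_ge0 ?(ltW (wallis_gt0 R n)) // exprn_ge0 // sh_ge0.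
set T := odd_primitive _ _ _ in H1 H2 *.
have -> : weight n s * (g * T) - weight n s * (2 * g * B) = weight n s * g
  * (T - 2 * B) by ring.
rewrite normrM (gtr0_norm (mulr_gt0 w0 g0)).
have -> : weight n s * (2 * g * B) * (12 * (s / n%:R))
  = weight n s * g * (2 * B * (12 * (s / n%:R))) by ring.
rewrite (ler_pM2l (mulr_gt0 w0 g0)).
have Bq : 2 * B * (sh (ln s) ^+ 2 / (8 * (2 * n%:R + 3))) <= 2 * B
  * (12 * (s / n%:R)).
  by rewrite ler_wpM2l // mulr_ge0.
have Bs : 0 <= 2 * B * (12 * (s / n%:R)).
  have sn : 0 <= s / n%:R by rewrite divr_ge0 // ltW.
  by apply: mulr_ge0; [lra|lra].
rewrite ler_norml; apply/andP; split; last by lra.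
by rewrite mulrBr mulr1 in H2; lra.
Qed.

(** For s <= 1 the argument ln s is not positive and only the crude bound applies; the power of s
    left over is at most 1, and (s + 1)^(2n) <= 4^n. *)
Lemma denom_integrand_near0 (s : R) : 0 < s <= 1 ->
  `|denom_integrand n s / scale| <= 4 * 4 ^+ n / beta.
Proof.
move=> /andP[s0 s1]; have k0 := scale_gt0; have w0 := weight_gt0 s.
have g0 : 0 < g := jacobi_const_gt0 R n; have b0 : 0 < beta := wallis_gt0 R n.
have l0 : ln s <= 0 by rewrite ln_le0.
have H := scaled_jacobi_le_crude n l0; rewrite -/nu -/g in H.
rewrite ger0_norm; last first.
  by rewrite divr_ge0 ?(ltW k0) // mulr_ge0 ?(ltW w0) // scaled_jacobi_ge0.
rewrite ler_pdivrMr // /scale.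
have -> : 4 * 4 ^+ n / beta * (4 * g * beta) = 2 * (8 * g * 4 ^+ n).
  by field; rewrite gt_eqF.
apply: (@le_trans _ _ (weight n s * (8 * g * ch (ln s) ^+ (2 * n)))).
  by rewrite /denom_integrand ler_pM2l.
have g8 : 0 < 8 * g by rewrite mulr_gt0.
rewrite mulrCA [leRHS]mulrCA (ler_pM2l g8).
rewrite ch_ln // exprMn -expRM_natl /weight -/nu.
rewrite -!mulrA ler_pM2l // mulrA -expRD.
have -> : 4 ^+ n = 2 ^+ (2 * n) :> R by rewrite exprM; congr (_ ^+ _); ring.
rewrite -[leRHS]mul1r ler_pM ?expR_ge0 ?exprn_ge0 //.
- by rewrite addr_ge0 // ltW.
- have n1 : (1 : R) <= n%:R by rewrite ler1n.
  by rewrite expR_le1 natrM /nu; have := sqr_ge0 s; nra.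
- by rewrite lerXn2r ?nnegrE // ?addr_ge0 ?(ltW s0) //; lra.
Qed.

(** From above the denominator integrand suffices. From below, the numerator evaluates y at -ln s >=
    0, outside the crude bound, so its excess over the denominator is written as an odd part and
    bounded by [scale]. *)
Lemma error_integrand_near0 (s : R) : 0 < s <= 1 ->
  `|error_integrand s / scale| <= 4 * 4 ^+ n / beta.
Proof.
move=> /andP[s0 s1]; have k0 := scale_gt0; have w0 := weight_gt0 s.
have g0 : 0 < g := jacobi_const_gt0 R n; have b0 : 0 < beta := wallis_gt0 R n.
have l0 : 0 <= - ln s by rewrite oppr_ge0 ln_le0.
have l1 : 0 <= numer_integrand n s
  by rewrite mulr_ge0 ?(ltW w0) ?scaled_jacobi_ge0.
have l2 : 0 <= denom_integrand n s
  by rewrite mulr_ge0 ?(ltW w0) ?scaled_jacobi_ge0.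
have b1 : beta <= 1 := wallis_le1 R n.
have n1 : (1 : R) <= n%:R by rewrite ler1n.
have big1 : 1 <= 4 * 4 ^+ n / beta.
  rewrite ler_pdivlMr // mul1r (le_trans b1) // -exprS exprn_ege1 //; lra.
have d0 : numer_integrand n s - denom_integrand n s <= scale.
  have -> : numer_integrand n s - denom_integrand n s
      = weight n s * (g * odd_primitive n (- ln s) (- ln s)).
    by rewrite -scaled_jacobi_odd /denom_integrand /numer_integrand -/nu opprK;
      ring.
  have H1 := odd_primitive_le n l0; rewrite -/beta in H1.
  apply: (@le_trans _ _ (weight n s
    * (2 * g * (beta * sh (- ln s) ^+ (2 * n).+1)))).
    have -> : 2 * g * (beta * sh (- ln s) ^+ (2 * n).+1)
      = g * (2 * (beta * sh (- ln s) ^+ (2 * n).+1)) by ring.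
    by rewrite !ler_pM2l.
  have e : sh (- ln s) = expR (- (ln s / 2)) * (1 - s).
    have -> : sh (- ln s) = - sh (ln s) by rewrite /sh mulNr opprK opprB.
    by rewrite sh_ln //; ring.
  rewrite (weight_main s0 e) -[leRHS]mulr1 ler_pM2l // -[leRHS]mulr1.
  apply: ler_pM; rewrite ?expR_ge0 ?exprn_ge0 ?subr_ge0 //.
    rewrite expR_le1; have := sqr_ge0 s.
    have := mulr_ge0 (ltac:(lra) : 0 <= 2 * n%:R - 2 / 3 :> R) l0; lra.
  by apply: exprn_ile1; [rewrite subr_ge0|rewrite gerBl ltW].
have s01 : 0 < s <= 1 by rewrite s0.
have S1 := denom_integrand_near0 s01.
have {}S1 : denom_integrand n s / scale <= 4 * 4 ^+ n / beta.
  by apply: le_trans S1; exact: ler_norm.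
rewrite /error_integrand ler_norml; apply/andP; split.
  rewrite lerNl -mulNr opprB ler_pdivrMr // (le_trans d0) // ler_peMl //.
  exact: ltW.
apply: le_trans S1; rewrite ler_pM2r ?invr_gt0 //; lra.
Qed.
End integrand_bounds.

(** * Integration of the pointwise estimates *)

Section laplace_integral.
Variables (R : realType) (n : nat) (V eps : R).
Notation mu := (@lebesgue_measure R).
Hypothesis n_gt0 : (0 < n)%N.
Hypothesis V_large : 20 <= V.
Hypothesis lnV_large : 3 <= ln V.
Hypothesis V_sqr : V ^+ 2 = 2 * n%:R.
Hypothesis eps_sign : eps = 1 \/ eps = -1.
Let K : R := laplace_const R.
Let V0 : 0 < V. Proof. by move: V_large; lra. Qed.

(** [main_norm] grows like e^(2 V^2 ln V - V^2), which beats 4^n / beta_n even after the loss of at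
    most (V + 1)^2 / 4 in [gauss_tail]. *)
Lemma near0_growth (s : R) : 0 < s <= 1 ->
  4 * 4 ^+ n / wallis R n <= K / V * gauss_tail V eps s * main_norm n V eps.
Proof.
move=> /andP[s0 s1]; have vl := V_large; have v0 := V0; have ll := lnV_large.
have b0 := wallis_gt0 R n; have b1 := wallis_le1 R n;
  have bs := wallis_sqr_ge R n.
have n1 : (1 : R) <= n%:R by rewrite ler1n.
have e1 : -1 <= eps <= 1 by case: eps_sign => ->; apply/andP; split; lra.
have K1 : 1 <= K.
  by rewrite /K /laplace_const; have := expR_ge1Dx (7 : R); lra.
have e2 : 2 <= expR 1 :> R by have := expR_ge1Dx (1 : R); lra.
have f4 : 4 ^+ n <= expR (V ^+ 2).
  rewrite V_sqr mulrC expRM_natl lerXn2r ?nnegrE ?expR_ge0 //.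
  have -> : expR 2 = expR 1 ^+ 2 :> R by rewrite -expRM_natl mulr1.
  by have := expR_gt0 (1 : R); nra.
have e48 : 48 <= expR 6 :> R.
  have -> : expR 6 = expR 1 ^+ 6 :> R by rewrite -expRM_natl mulr1.
  apply: (@le_trans _ _ (2 ^+ 6)); first by lra.
  by rewrite lerXn2r ?nnegrE ?expR_ge0.
(* Prepares 4 (V^2 + 1) V <= 8 V^3 <= 48 e^V <= e^(V + 6). *)
have V3 := expR_ge1Dxn 2 (ltW v0).
have {}V3 : V ^+ 3 <= 6 * expR V.
  by move: V3; rewrite (_ : 3`!%:R = 6) //; lra.
have bV : (wallis R n)^-1 <= V ^+ 2 + 1.
  rewrite V_sqr -[leLHS]mul1r ler_pdivrMr // (le_trans bs) // mulrC.
  by rewrite ler_pM2l ?expr2 ?ler_piMl // ?ltW //; lra.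
apply: (@le_trans _ _ (expR (V + 6 + V ^+ 2) / V)).
  rewrite ler_pdivlMr //.
  apply: (@le_trans _ _ (4 * expR (V ^+ 2) * (V ^+ 2 + 1) * V)).
    rewrite ler_pM2r //; apply: ler_pM => //; last by rewrite ler_pM2l.
    by rewrite invr_ge0 ltW.
  have -> : 4 * expR (V ^+ 2) * (V ^+ 2 + 1) * V = (4 * (V ^+ 2 + 1) * V)
    * expR (V ^+ 2) by ring.
  rewrite [expR (V + 6 + _)]expRD ler_pM2r ?expR_gt0 // expRD.
  apply: (@le_trans _ _ (8 * V ^+ 3)); first by nra.
  by have := expR_gt0 V; nra.
rewrite -[K / V * _ * _]mulrA [K / V * _]mulrAC ler_pM2r ?invr_gt0 //.
rewrite -[leLHS]mul1r ler_pM ?expR_ge0 //.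
rewrite /gauss_tail /main_norm -expRD ler_expR.
set w := shifted V eps s.
have wV : w ^+ 2 <= (V + 1) ^+ 2.
  have w1 : - (V + 1) <= w by rewrite /w /shifted; lra.
  have w2 : w <= V + 1 by rewrite /w /shifted; lra.
  nra.
(* Here ln V >= 3 enters: 4n ln V = 2 V^2 ln V pays for all quadratic terms in V. *)
have h : 6 * V ^+ 2 <= (4 * n%:R + 1 / 3) * ln V.
  have -> : 4 * n%:R = 2 * V ^+ 2 :> R by rewrite V_sqr; ring.
  have := sqr_ge0 V; nra.
have eV : - V <= eps * V by nra.
nra.
Qed.

Variable f : R -> R.
Hypothesis f_main : forall s, 1 < s ->
  `|f s - main_term n eps s| <= main_term n eps s * (12 * (s / n%:R)).
Hypothesis f_near0 : forall s, 0 < s <= 1 -> `|f s| <= 4 * 4 ^+ n / wallis R n.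

Lemma main_norm_gt0 : 0 < main_norm n V eps.
Proof. exact: expR_gt0. Qed.

Lemma gauss_tail_ge0 (s : R) : 0 <= gauss_tail V eps s.
Proof. exact: expR_ge0. Qed.

Lemma laplace_const_div_ge0 : 0 <= K / V.
Proof. by rewrite divr_ge0 ?(ltW V0) // mulr_ge0 // expR_ge0. Qed.

(** For s > 1 the relative error of f contributes 12 and [main_term_close] 1; for s <= 1 both terms
    are separately small. *)
Lemma laplace_integrand_close (s : R) : 0 < s ->
  `|f s / main_norm n V eps - gauss_main V eps s| <= 14 * K / V
    * gauss_tail V eps s.
Proof.
move=> s0; have m0 := main_norm_gt0; have t0 := gauss_tail_ge0 s;
  have k0 := laplace_const_div_ge0.
have kt : 0 <= K / V * gauss_tail V eps s by rewrite mulr_ge0.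
have -> : 14 * K / V * gauss_tail V eps s = 14
  * (K / V * gauss_tail V eps s) by rewrite !mulrA.
have [s1|s1] := leP s 1.
  have h1 : `|f s / main_norm n V eps| <= K / V * gauss_tail V eps s.
    rewrite normrM [X in _ * X]gtr0_norm ?invr_gt0 // ler_pdivrMr //.
    by apply: le_trans (near0_growth _); [apply: f_near0|]; rewrite s0.
  have h2 := gauss_main_small V_large eps_sign s1.
  have h3 : 0 <= gauss_main V eps s by exact: expR_ge0.
  rewrite (le_trans (ler_normB _ _)) // [X in _ + X]ger0_norm //.
  by rewrite -/K in h2; lra.
have h1 := main_term_close V_large V_sqr eps_sign s1; rewrite -/K in h1.
have h2 := main_term_moment V_large V_sqr eps_sign s1; rewrite -/K in h2.
have -> : f s / main_norm n V eps - gauss_main V eps s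
  = (f s - main_term n eps s) / main_norm n V eps
    + (main_term n eps s / main_norm n V eps - gauss_main V eps s) by ring.
rewrite (le_trans (ler_normD _ _)) //.
have h3 : `|(f s - main_term n eps s) / main_norm n V eps|
    <= 12 * (main_term n eps s / main_norm n V eps * (s / n%:R)).
  rewrite normrM [X in _ * X]gtr0_norm ?invr_gt0 //.
  have -> : 12 * (main_term n eps s / main_norm n V eps * (s / n%:R))
    = main_term n eps s * (12 * (s / n%:R)) / main_norm n V eps by ring.
  by rewrite ler_pM2r ?invr_gt0 // f_main.
lra.
Qed.

Definition gauss_mass (sigma : R) := (normal_peak sigma)^-1.

Lemma Rintegral_normal_fun (m sigma : R) : sigma != 0 ->
  mu.-integrable setT (EFin \o normal_fun m sigma) /\
  \int[mu]_x normal_fun m sigma x = gauss_mass sigma.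
Proof.
move=> s0; have p0 : normal_peak sigma != 0 by rewrite gt_eqF //
  normal_peak_gt0.
have e : normal_fun m sigma = fun x => gauss_mass sigma * normal_pdf m sigma x.
  by apply/funext => x; rewrite normal_pdfE // mulrA mulVf // mul1r.
have ip := integrable_normal_pdf m sigma.
split.
  rewrite e; have -> : EFin \o (fun x => gauss_mass sigma
    * normal_pdf m sigma x)
     = (fun x => (gauss_mass sigma)%:E * (normal_pdf m sigma x)%:E)%E.
    by apply/funext => x; rewrite /= EFinM.
  exact: integrableZl.
rewrite e RintegralZl //.
by rewrite /Rintegral integral_normal_pdf mulr1.
Qed.

(** Completing the square turns -2 w^2 + eps w into -2 (w - eps/4)^2 + 1/8. As only eps^2 enters the
    constant, both signs have the same mass, and the quotient of the two integrals has leading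
    constant 1. *)
Lemma gauss_main_normal : gauss_main V eps
  = fun s => expR (1 / 8) * normal_fun (V - eps / 2 + eps / 4) (1 / 2) s.
Proof.
apply/funext => s; rewrite /normal_fun -expRD; congr expR; rewrite /shifted.
by case: eps_sign => ->; field.
Qed.

Lemma gauss_tail_normal : gauss_tail V eps
  = normal_fun (V - eps / 2) (Num.sqrt 2).
Proof.
apply/funext => s; rewrite /normal_fun; congr expR;
  rewrite /shifted sqr_sqrtr //.
by field.
Qed.

Hypothesis f_integrable : mu.-integrable `]0, +oo[ (EFin \o f).

Lemma laplace_integral :
  `|(\int[mu]_(s in `]0, +oo[) f s) / main_norm n V eps
    - expR (1 / 8) * gauss_mass (1 / 2)|
  <= 14 * K / V * gauss_mass (Num.sqrt 2).
Proof.
have m0 := main_norm_gt0.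
have half0 : (1 / 2 : R) != 0 by rewrite gt_eqF.
have sqrt0 : Num.sqrt (2 : R) != 0 by rewrite gt_eqF // sqrtr_gt0.
have [im1 im2] := Rintegral_normal_fun (V - eps / 2 + eps / 4) half0.
have [it1 it2] := Rintegral_normal_fun (V - eps / 2) sqrt0.
have iZ (D : set R) (c : R) (h : R -> R) : measurable D ->
  mu.-integrable D (EFin \o h) ->
    mu.-integrable D (EFin \o (fun x => c * h x)).
  move=> mD ih; have -> : EFin \o (fun x => c * h x)
    = (fun x => c%:E * (EFin \o h) x)%E.
    by apply/funext => x; rewrite /= EFinM.
  exact: integrableZl.
pose D : set R := `]0, +oo[%classic.
have fi : mu.-integrable D (EFin \o f) by exact: f_integrable.
rewrite -/D.
have mD : measurable D by exact: measurable_itv.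
pose F := f \_ D.
(* f is extended by 0 to the whole line, where the Gaussian integrals are known; for s <= 0 the
   Gaussian itself is within the error. *)
have iF : mu.-integrable setT (EFin \o F).
  by rewrite -restrict_EFin; apply/integrable_restrict => //; rewrite setTI.
have iF' := iZ _ (main_norm n V eps)^-1 _ measurableT iF.
have im := iZ _ (expR (1 / 8)) _ measurableT im1;
  rewrite -gauss_main_normal in im.
rewrite -gauss_tail_normal in it1 it2.
have it := iZ _ (14 * K / V) _ measurableT it1.
have -> : expR (1 / 8) * gauss_mass (1 / 2) = \int[mu]_s gauss_main V eps s.
  by rewrite gauss_main_normal RintegralZl // im2.
rewrite -it2 -RintegralZl // mulrC Rintegral_mkcond -/F -RintegralZl //
  -RintegralB //.
have iB : mu.-integrable setT (EFin \o
    (fun s => (main_norm n V eps)^-1 * F s - gauss_main V eps s)).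
  have -> : EFin \o (fun s => (main_norm n V eps)^-1 * F s - gauss_main V eps s)
      = ((EFin \o (fun s => ((main_norm n V eps)^-1 * F s)%R))
         \- (EFin \o gauss_main V eps))%E.
    by apply/funext => s; rewrite /= EFinB.
  exact: integrableB.
apply: le_trans (le_normr_Rintegral _ iB) _ => //.
apply: le_Rintegral => //; first exact: (integrable_norm iB).
move=> s _; rewrite /F patchE.
have [sD|sD] := boolP (s \in D).
  rewrite mulrC laplace_integrand_close //.
  by move: sD; rewrite inE /D /= in_itv /= andbT.
have s0 : s <= 0.
  by move: sD; rewrite notin_setE /D /= in_itv /= andbT => /negP;
    rewrite -leNgt.
have h2 := gauss_main_small V_large eps_sign (le_trans s0 ler01).
rewrite mulr0 sub0r normrN ger0_norm ?expR_ge0 //.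
have kt : 0 <= K / V * gauss_tail V eps s
  by rewrite mulr_ge0 ?laplace_const_div_ge0 ?gauss_tail_ge0.
by rewrite -/K in h2; lra.
Qed.
End laplace_integral.

(** * Asymptotics of the quotient *)

Section asymptotics.
Variable R : realType.
Notation mu := (@lebesgue_measure R).
Let nu : R := 1 / 6.

Lemma measurable_hyp_fun n (e : R) : measurable_fun setT (fun s : R =>
  scaled_jacobi nu n (e * ln s)).
Proof.
apply: measurable_sum => k; apply: measurable_funM => //.
apply: measurableT_comp => //; apply: measurable_funM => //.
by apply: measurable_funM => //; exact: measurable_ln.
Qed.

Lemma measurable_weight n : measurable_fun setT (@weight R n).
Proof.
apply: measurable_funM => //; apply: measurableT_comp => //.
apply: measurable_funB; last exact: exprn_measurable.
by apply: measurable_funM => //; exact: measurable_ln.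
Qed.

Lemma nonneg_integrable (f : R -> R) (I : R) : measurable_fun setT f ->
  (forall s, 0 <= f s) ->
  (\int[mu]_(s in `]0%R, +oo[) (f s)%:E = I%:E)%E ->
  mu.-integrable `]0, +oo[ (EFin \o f) /\ \int[mu]_(s in `]0, +oo[) f s = I.
Proof.
move=> mf f0 fI; split; last by rewrite /Rintegral fI.
apply/integrableP; split; first by apply/measurable_EFinP/measurable_funTS.
under eq_integral do rewrite /= ger0_norm //.
by rewrite fI ltry.
Qed.

Lemma denom_integrable n : mu.-integrable `]0,
  +oo[ (EFin \o denom_integrand n) /\
  \int[mu]_(s in `]0, +oo[) denom_integrand n s = Gamma (1 / 2) * q_seq R n.
Proof.
apply: nonneg_integrable (integral_denom R n).
  apply: measurable_funM; first exact: measurable_weight.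
  have -> : (fun s => scaled_jacobi (1 / 6) n (ln s))
    = (fun s => scaled_jacobi nu n (1 * ln s)).
    by apply/funext => s; rewrite [1 * ln s]mul1r.
  exact: measurable_hyp_fun.
by move=> s; rewrite mulr_ge0 ?(ltW (weight_gt0 n s)) ?scaled_jacobi_ge0.
Qed.

Lemma numer_integrable n : mu.-integrable `]0,
  +oo[ (EFin \o numer_integrand n) /\
  \int[mu]_(s in `]0, +oo[) numer_integrand n s = Gamma (1 / 3) * p_seq R n.
Proof.
apply: nonneg_integrable (integral_numer R n).
  apply: measurable_funM; first exact: measurable_weight.
  have -> : (fun s => scaled_jacobi (1 / 6) n (- ln s))
    = (fun s => scaled_jacobi nu n (-1 * ln s)).
    by apply/funext => s; rewrite [-1 * ln s]mulN1r.
  exact: measurable_hyp_fun.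
by move=> s; rewrite mulr_ge0 ?(ltW (weight_gt0 n s)) ?scaled_jacobi_ge0.
Qed.

Definition limit_mass : R := expR (1 / 8) * gauss_mass (1 / 2).
Definition error_const : R := 14 * laplace_const R * gauss_mass (Num.sqrt 2).

Lemma gauss_mass_gt0 (s : R) : s != 0 -> 0 < gauss_mass s.
Proof. by move=> s0; rewrite invr_gt0 normal_peak_gt0. Qed.

Lemma limit_mass_gt0 : 0 < limit_mass.
Proof. by rewrite mulr_gt0 ?expR_gt0 // gauss_mass_gt0 // gt_eqF. Qed.

Lemma error_const_gt0 : 0 < error_const.
Proof.
rewrite mulr_gt0 ?gauss_mass_gt0 // ?gt_eqF ?sqrtr_gt0 //.
by rewrite mulr_gt0 // mulr_gt0 // expR_gt0.
Qed.

Lemma integrable_scale (D : set R) (c : R) (h : R -> R) : measurable D ->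
  mu.-integrable D (EFin \o h) -> mu.-integrable D (EFin \o (fun x => h x / c)).
Proof.
move=> mD ih; have -> : EFin \o (fun x => h x / c)
  = (fun x => (c^-1)%:E * (EFin \o h) x)%E.
  by apply/funext => x; rewrite /= EFinM muleC.
exact: integrableZl.
Qed.

Lemma denom_asymp n V : (0 < n)%N -> 20 <= V -> 3 <= ln V -> V ^+ 2 = 2
  * n%:R ->
  `|Gamma (1 / 2) * q_seq R n / (scale R n * main_norm n V 1) - limit_mass|
  <= error_const / V.
Proof.
move=> n0 V1 V2 V3; have [id vd] := denom_integrable n.
have mD : measurable (`]0, +oo[%classic : set R) by exact: measurable_itv.
have := @laplace_integral R n V 1 n0 V1 V2 V3 (or_introl erefl)
  (fun s => denom_integrand n s / scale R n)
  (@denom_integrand_close R n n0) (@denom_integrand_near0 R n n0)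
    (integrable_scale (scale R n) mD id).
have -> : (\int[mu]_(s in `]0, +oo[) (denom_integrand n s / scale R n))
    = Gamma (1 / 2) * q_seq R n / scale R n.
  under eq_Rintegral do rewrite mulrC.
  by rewrite RintegralZl // vd mulrC.
move=> H; have -> : error_const / V = 14 * laplace_const R / V
  * gauss_mass (Num.sqrt 2).
  by rewrite /error_const mulrAC.
by rewrite [(scale R n * _)^-1]invfM mulrA.
Qed.

Lemma error_asymp n V : (0 < n)%N -> 20 <= V -> 3 <= ln V -> V ^+ 2 = 2
  * n%:R ->
  `|(Gamma (1 / 2) * q_seq R n - Gamma (1 / 3) * p_seq R n)
    / (scale R n * main_norm n V (-1)) - limit_mass|
  <= error_const / V.
Proof.
move=> n0 V1 V2 V3; have [id vd] := denom_integrable n;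
  have [in_ vn] := numer_integrable n.
have mD : measurable (`]0, +oo[%classic : set R) by exact: measurable_itv.
have ie : mu.-integrable `]0, +oo[ (EFin \o @error_integrand R n).
  have -> : EFin \o @error_integrand R n
      = ((EFin \o denom_integrand n) \- (EFin \o numer_integrand n))%E.
    by apply/funext => s; rewrite /= -EFinB.
  exact: integrableB.
have := @laplace_integral R n V (-1) n0 V1 V2 V3 (or_intror erefl)
  (fun s => error_integrand n s / scale R n)
  (@error_integrand_close R n n0) (@error_integrand_near0 R n n0)
    (integrable_scale (scale R n) mD ie).
have -> : (\int[mu]_(s in `]0, +oo[) (error_integrand n s / scale R n))
    = (Gamma (1 / 2) * q_seq R n - Gamma (1 / 3) * p_seq R n) / scale R n.
  under eq_Rintegral do rewrite mulrC.
  by rewrite RintegralZl // RintegralB // vd vn mulrC.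
move=> H; have -> : error_const / V = 14 * laplace_const R / V
  * gauss_mass (Num.sqrt 2).
  by rewrite /error_const mulrAC.
by rewrite [(scale R n * _)^-1]invfM mulrA.
Qed.

Lemma quotient_close (G d x1 x2 : R) : 0 < G -> d <= G / 2 ->
  `|x1 - G| <= d -> `|x2 - G| <= d ->
  0 < x1 /\ 0 < x2 /\ x2 <= 3 * x1 /\ `|x2 / x1 - 1| <= 4 * d / G.
Proof.
move=> G0 dG /ler_normlP[a1 a2] /ler_normlP[b1 b2].
have x10 : 0 < x1 by lra.
do 3![split; first by lra].
have -> : x2 / x1 - 1 = (x2 - x1) / x1 by field; rewrite gt_eqF.
have -> : 4 * d / G = (2 * d) / (G / 2) by field; rewrite gt_eqF.
rewrite normrM [X in _ * X]gtr0_norm ?invr_gt0 //; apply: ler_pM => //.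
- by rewrite invr_ge0 ltW.
- by rewrite ler_norml; apply/andP; split; lra.
- by rewrite lef_pV2 ?posrE ?divr_gt0 //; lra.
Qed.

(** With S = sqrt(pi) q_n and P = Gamma(1/3) p_n the left difference is sqrt(pi)/Gamma(1/3) times (S
    - P)/S. In this quotient [scale], the common part of [main_norm] and the Gaussian mass all
    cancel. *)
Lemma quotient_asymp n V : (0 < n)%N -> 20 <= V -> 3 <= ln V ->
  error_const / V <= limit_mass / 2 -> V ^+ 2 = 2 * n%:R ->
  `|(Gamma (1 / 2) / Gamma (1 / 3) - p_seq R n / q_seq R n) * expR (2 * V)
     - Num.sqrt pi / Gamma (1 / 3)|
  <= `|Num.sqrt pi / Gamma (1 / 3)| * (4 * error_const / limit_mass / V).
Proof.
move=> n0 V1 V2 Vd V3.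
have h1 := denom_asymp n0 V1 V2 V3; have h2 := error_asymp n0 V1 V2 V3.
have sc := scale_gt0 R n; have N1 := main_norm_gt0 n V 1.
have Nm : main_norm n V (-1) = main_norm n V 1 * expR (- (2 * V)).
  by rewrite /main_norm -expRD; congr expR; ring.
rewrite Nm in h2; move: h1 h2; rewrite Gamma_half.
set S := Num.sqrt pi * q_seq R n; set P := Gamma (1 / 3) * p_seq R n.
have pi0 : 0 < Num.sqrt (pi : R) by rewrite sqrtr_gt0 pi_gt0.
have e0 : 0 < expR (- (2 * V)) by exact: expR_gt0.
set M := scale R n * main_norm n V 1; have M0 : 0 < M by exact: mulr_gt0.
have -> : scale R n * (main_norm n V 1 * expR (- (2 * V))) = M
  * expR (- (2 * V)) by rewrite mulrA.
set x1 := S / M; set x2 := (S - P) / (M * expR (- (2 * V))) => h1 h2.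
have [x10 [x20 [x23 xr]]] := quotient_close limit_mass_gt0 Vd h1 h2.
have SE : S = M * x1 by rewrite /x1; field; rewrite gt_eqF.
have PE : S - P = M * expR (- (2 * V)) * x2 by rewrite /x2; field;
  rewrite !gt_eqF.
have e3 : expR (- (2 * V)) <= 1 / 41.
  rewrite expRN -[leLHS]div1r ler_pdivrMr ?expR_gt0 //.
  by have := expR_ge1Dx (2 * V); lra.
(* Since e^(-2V) x2 <= 3 x1 / 41 < x1. Positivity of P is what shows that Gamma(1/3) is not 0. *)
have P0 : 0 < P.
  have -> : P = M * (x1 - expR (- (2 * V)) * x2)
    by rewrite mulrBr -SE mulrA -PE; ring.
  by rewrite mulr_gt0 //; nra.
have q0 : q_seq R n != 0.
  by apply/eqP => q0; move: SE; rewrite /S q0 mulr0 => /esym/eqP;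
    rewrite mulf_eq0 !gt_eqF.
have g0 : Gamma (1 / 3 : R) != 0.
  by apply/eqP => g0; move: P0; rewrite /P g0 mul0r ltxx.
have -> : (Num.sqrt pi / Gamma (1 / 3) - p_seq R n / q_seq R n) * expR (2 * V)
     - Num.sqrt pi / Gamma (1 / 3) = Num.sqrt pi / Gamma (1 / 3)
       * (x2 / x1 - 1).
  have -> : x2 / x1 = (S - P) / S * expR (2 * V).
    rewrite PE SE expRN; field; rewrite !gt_eqF //=.
    exact: expR_gt0.
  rewrite /S /P; field.
  by rewrite q0 g0 gt_eqF.
rewrite normrM ler_wpM2l //.
apply: (le_trans xr); have v0 : 0 < V by lra.
have -> : 4 * (error_const / V) / limit_mass = 4 * error_const / limit_mass / V.
  by field; rewrite !gt_eqF // limit_mass_gt0.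
by [].
Qed.
End asymptotics.

Lemma sqrt_large (R : realType) (M : R) :
  \forall n \near \oo, (0 < n)%N /\ M <= Num.sqrt (2 * n%:R).
Proof.
exists (Num.truncn (M ^+ 2)).+1 => // n /= Mn; split;
  first exact: leq_ltn_trans Mn.
have M2 : M ^+ 2 <= 2 * n%:R.
  have h : M ^+ 2 <= n%:R.
    by apply: le_trans (ltW (truncnS_gt _)) _; rewrite ler_nat.
  by have : 0 <= n%:R :> R by []; lra.
by apply: (le_trans (ler_norm M)); rewrite -sqrtr_sqr ler_sqrt.
Qed.

Lemma gamma_quotient_asymp (R : realType) :
  exists e : nat -> R,
    e =O_\oo (fun n : nat => n%:R `^ (- (1 / 2)) : R) /\
    forall n : nat,
      Gamma (1 / 2 : R) / Gamma (1 / 3) - p_seq R n / q_seq R n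
      = expR (- 2 * Num.sqrt (2 * n%:R)) * (Num.sqrt pi / Gamma (1 / 3) + e n).
Proof.
(* The error is defined by solving the identity, which thus holds for every n; only its size is
   asymptotic. *)
exists (fun n => (Gamma (1 / 2) / Gamma (1 / 3) - p_seq R n / q_seq R n)
  * expR (2 * Num.sqrt (2 * n%:R)) - Num.sqrt pi / Gamma (1 / 3)).
split=> [|n]; last first.
  by rewrite [X in _ = _ * X]addrC subrK mulrCA -expRD -mulrDl addNr mul0r
    expR0 mulr1.
have G0 := limit_mass_gt0 R; have C0 := error_const_gt0 R.
pose k := `|Num.sqrt pi / Gamma (1 / 3 : R)|
  * (4 * error_const R / limit_mass R).
(* The three summands secure V >= 20, ln V >= 3 and error_const / V <= limit_mass / 2. *)
pose M : R := 20 + expR 3 + 2 * error_const R / limit_mass R.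
(* Adding 1 makes the constant visibly positive, as [eqO_exP] requires. *)
apply/eqO_exP; exists (k + 1).
  by rewrite ltr_wpDl // mulr_ge0 // divr_ge0 ?(ltW G0) // mulr_ge0 // ltW.
near=> n; have [n0 MV] : (0 < n)%N /\ M <= Num.sqrt (2 * n%:R).
  by near: n; exact: sqrt_large.
set V := Num.sqrt (2 * n%:R) in MV *.
have e0 := expR_gt0 (3 : R).
have q0 : 0 < 2 * error_const R / limit_mass R by rewrite divr_gt0 // mulr_gt0.
have V20 : 20 <= V by rewrite /M in MV; lra.
have V0 : 0 < V by lra.
have V3 : 3 <= ln V.
  by rewrite -[3]expRK ler_ln ?posrE //; rewrite /M in MV; lra.
have Vd : error_const R / V <= limit_mass R / 2.
  have h : 2 * error_const R / limit_mass R <= V by rewrite /M in MV; lra.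
  rewrite ler_pdivrMr // in h; rewrite ler_pdivrMr //; lra.
have VV : V ^+ 2 = 2 * n%:R by rewrite sqr_sqrtr // mulr_ge0.
apply: (le_trans (quotient_asymp n0 V20 V3 Vd VV)).
have nz : 0 < Num.sqrt (n%:R : R) by rewrite sqrtr_gt0 ltr0n.
have -> : n%:R `^ (- (1 / 2)) = (Num.sqrt n%:R)^-1 :> R.
  by rewrite powRN div1r powR12_sqrt.
rewrite [X in _ <= _ * X]gtr0_norm ?invr_gt0 // mulrA -/k.
have k0 : 0 <= k by rewrite mulr_ge0 // divr_ge0 ?(ltW G0) // mulr_ge0 // ltW.
apply: ler_pM => //; first by rewrite invr_ge0 ltW.
  by rewrite lerDl.
rewrite lef_pV2 ?posrE // ler_wsqrtr //.
by have : 0 <= n%:R :> R by []; lra.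
Unshelve. all: by end_near. Qed.

Theorem corollary1 (R : realType) :
  [/\ satisfies_recurrence (@p_seq R) /\ satisfies_recurrence (@q_seq R),
      [/\ p_seq R 0 = 1, p_seq R 1 = 43 / 54 & p_seq R 2 = 12871%:R / 1458%:R],
      [/\ q_seq R 0 = 1, q_seq R 1 = 29 / 24 & q_seq R 2 = 5149%:R / 384]
    & exists e : nat -> R,
        e =O_\oo (fun n : nat => n%:R `^ (- (1 / 2)) : R) /\
        forall n : nat,
          Gamma (1 / 2 : R) / Gamma (1 / 3) - p_seq R n / q_seq R n
          = expR (- 2 * Num.sqrt (2 * n%:R))
            * (Num.sqrt pi / Gamma (1 / 3) + e n) ].
Proof.
split.
- by split; [exact: p_seq_recurrence|exact: q_seq_recurrence].
- exact: p_seq_initial.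
- exact: q_seq_initial.
- exact: gamma_quotient_asymp.
Qed.
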